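(* For every entangled bipartite state $\rho$, $$\frac{E_D(\rho)}{E_c(\rho)}\le \mathcal S_E^{as}(\rho)\le 1,$$ equivalently $\dfrac{E_b(\rho)}{E_c(\rho)}\ge\mathcal A_E^{as}(\rho)$, where $E_b=E_c-E_D$. In particular, if $\mathcal A_E^{as}(\rho)>0$ then $E_D(\rho)<E_c(\rho)$.
   Context: $V$ is the swap of subsystems, $V(x\otimes y)=y\otimes x$. For bipartite states $\rho,\sigma$, the transition rate $R(\rho\to\sigma)$ is the supremum of all $r\ge0$ such that there exist LOCC operations $\Lambda_n$ and integers $m_n$ with $m_n/n\to r$ and $\|\Lambda_n(\rho^{\otimes n})-\sigma^{\otimes m_n}\|_1\to0$. The round-trip rate is $R(\rho\rightleftharpoons\sigma)=R(\rho\to\sigma)R(\sigma\to\rho)$ with $0\cdot\infty=\infty\cdot0=0$. The symmetry of entanglement is $\mathcal S_E^{as}(\rho)=R(\rho\to V\rho V^\dagger)$, which equals $\sup_\sigma R(\rho\rightleftharpoons\sigma)$ over all swap-invariant states $\sigma$ ($V\sigma V=\sigma$); the asymmetry of entanglement is $\mathcal A_E^{as}=1-\mathcal S_E^{as}$. With $\psi_+=\frac1{\sqrt2}(|00\rangle+|11\rangle)$, distillable entanglement is $E_D(\rho)=R(\rho\to\psi_+)$ and entanglement cost is $E_c(\rho)=1/R(\psi_+\to\rho)$; $E_c(\rho)>0$ for every entangled state $\rho$. *)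

(* Defs.v *)
From HB Require Import structures.
From mathcomp Require Import all_boot all_order all_algebra.
From mathcomp Require Import complex.
From mathcomp Require Import all_classical all_reals all_analysis.
Set Implicit Arguments. Unset Printing Implicit Defensive.
Import Order.TTheory GRing.Theory Num.Theory.
Import numFieldNormedType.Exports.
Local Open Scope classical_set_scope.
Local Open Scope ring_scope.

Section Quantum.
Variable R : realType.
Local Notation C := R[i].

(** Matrices with rows indexed by the finite type T and columns by U
    (i.e. linear maps C^U -> C^T in the computational bases). *)
Definition mat (T U : finType) := T -> U -> C.

Definition mulm (T U V : finType) (X : mat T U) (Y : mat U V) : mat T V :=
  fun i k => \sum_(j : U) X i j * Y j k.
Definition adjm (T U : finType) (X : mat T U) : mat U T :=
  fun j i => conjc (X i j).
Definition idm (T : finType) : mat T T := fun i j => (i == j)%:R.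
Definition subm (T U : finType) (X Y : mat T U) : mat T U :=
  fun i j => X i j - Y i j.
Definition trm (T : finType) (X : mat T T) : C := \sum_(i : T) X i i.
Definition kron (T U T' U' : finType) (X : mat T U) (Y : mat T' U')
  : mat (T * T')%type (U * U')%type := fun i j => X i.1 j.1 * Y i.2 j.2.
Definition sandw (T U : finType) (K : mat T U) (X : mat U U) : mat T T :=
  mulm (mulm K X) (adjm K).
Arguments mulm {T U V}.
Arguments adjm {T U}.
Arguments idm  T.
Arguments subm {T U}.
Arguments trm {T}.
Arguments kron {T U T' U'}.
Arguments sandw {T U}.

Definition psd (T : finType) (X : mat T T) : Prop :=
  forall v : T -> C, 0 <= \sum_(i : T) \sum_(j : T) conjc (v i) * X i j * v j.
Definition is_state (T : finType) (X : mat T T) : Prop := psd X /\ trm X = 1.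
Arguments psd {T}.
Arguments is_state {T}.

Definition unitary (T : finType) (U : mat T T) : Prop :=
  mulm (adjm U) U = @idm T.
Arguments unitary {T}.

(** Trace norm, through the variational formula ||X||_1 = sup_U |tr(U X)|
    over unitaries U. *)
Definition tnorm (T : finType) (X : mat T T) : R :=
  sup [set Normc.normc (trm (mulm U X)) | U in [set U | unitary U]].
Arguments tnorm {T}.

Definition tp_kraus (I T U : finType) (K : I -> mat T U) : Prop :=
  forall x y, \sum_(k : I) mulm (adjm (K k)) (K k) x y = @idm U x y.
Arguments tp_kraus {I T U}.

Definition bop (A B : finType) := mat (A * B)%type (A * B)%type.

(** Finite-round LOCC channels from the bipartite system A:B to A':B'.
    - local: a product of local channels (given by Kraus families)
    - Alice (resp. Bob) performs an instrument with outcomes I (each outcome i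
      with Kraus operators K i j, j : J), broadcasts the outcome, and the
      protocol continues with an LOCC channel Psi i depending on i. *)
Inductive LOCC : forall (A B A' B' : finType), (bop A B -> bop A' B') -> Prop :=
| LOCC_local (A B A' B' I J : finType) (K : I -> mat A' A) (L : J -> mat B' B) :
    tp_kraus K -> tp_kraus L ->
    LOCC (fun X => fun x y =>
            \sum_(i : I) \sum_(j : J) sandw (kron (K i) (L j)) X x y)
| LOCC_Alice (A B A'' A' B' I J : finType) (K : I -> J -> mat A'' A)
    (Psi : I -> bop A'' B -> bop A' B') :
    tp_kraus (fun ij : (I * J)%type => K ij.1 ij.2) ->
    (forall i, LOCC (Psi i)) ->
    LOCC (fun X => fun x y =>
            \sum_(i : I) Psi i (fun u v =>
               \sum_(j : J) sandw (kron (K i j) (@idm B)) X u v) x y)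
| LOCC_Bob (A B B'' A' B' I J : finType) (L : I -> J -> mat B'' B)
    (Psi : I -> bop A B'' -> bop A' B') :
    tp_kraus (fun ij : (I * J)%type => L ij.1 ij.2) ->
    (forall i, LOCC (Psi i)) ->
    LOCC (fun X => fun x y =>
            \sum_(i : I) Psi i (fun u v =>
               \sum_(j : J) sandw (kron (@idm A) (L i j)) X u v) x y).

Definition tpow (A B : finType) (rho : bop A B) (n : nat)
  : bop {ffun 'I_n -> A} {ffun 'I_n -> B} :=
  fun x y => \prod_(k < n) rho (x.1 k, x.2 k) (y.1 k, y.2 k).
Arguments tpow {A B}.

Definition achievable (A B A' B' : finType) (rho : bop A B) (sigma : bop A' B')
  (r : R) : Prop :=
  0 <= r /\
  exists (m : nat -> nat)
    (Lam : forall n, bop {ffun 'I_n -> A} {ffun 'I_n -> B} ->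
                     bop {ffun 'I_(m n) -> A'} {ffun 'I_(m n) -> B'}),
    (forall n, LOCC (Lam n)) /\
    ((fun n => (m n)%:R / n%:R : R) @ \oo --> r) /\
    ((fun n => tnorm (subm (Lam n (tpow rho n)) (tpow sigma (m n)))) @ \oo
       --> (0 : R)).
Arguments achievable {A B A' B'}.

Definition rate (A B A' B' : finType) (rho : bop A B) (sigma : bop A' B')
  : \bar R := ereal_sup [set r%:E | r in achievable rho sigma].
Arguments rate {A B A' B'}.

Definition swapop (A B : finType) (rho : bop A B) : bop B A :=
  fun x y => rho (x.2, x.1) (y.2, y.1).
Arguments swapop {A B}.

Definition psi_plus : bop 'I_2 'I_2 :=
  fun x y => if (x.1 == x.2) && (y.1 == y.2) then 2^-1 else 0.
Arguments psi_plus .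

Definition E_D (A B : finType) (rho : bop A B) : \bar R := rate rho psi_plus.
Definition E_c (A B : finType) (rho : bop A B) : \bar R :=
  ((rate psi_plus rho)^-1)%E.
Definition E_b (A B : finType) (rho : bop A B) : \bar R :=
  (E_c rho - E_D rho)%E.
Definition sym_ent (A B : finType) (rho : bop A B) : \bar R :=
  rate rho (swapop rho).
Definition asym_ent (A B : finType) (rho : bop A B) : \bar R :=
  (1 - sym_ent rho)%E.
Arguments E_D {A B}.
Arguments E_c {A B}.
Arguments E_b {A B}.
Arguments sym_ent {A B}.
Arguments asym_ent {A B}.

Definition separable (A B : finType) (rho : bop A B) : Prop :=
  exists (k : nat) (p : 'I_k -> R) (alpha : 'I_k -> mat A A)
         (beta : 'I_k -> mat B B),
    (forall i, 0 <= p i) /\ \sum_(i < k) p i = 1 /\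
    (forall i, is_state (alpha i) /\ is_state (beta i)) /\
    forall x y, rho x y = \sum_(i < k) Complex (p i) 0 * kron (alpha i) (beta i) x y.
Arguments separable {A B}.

Definition entangled (A B : finType) (rho : bop A B) : Prop :=
  is_state rho /\ ~ separable rho.
Arguments entangled {A B}.

End Quantum.

Arguments mulm {R T U V}.
Arguments adjm {R T U}.
Arguments idm {R} T.
Arguments subm {R T U}.
Arguments trm {R T}.
Arguments kron {R T U T' U'}.
Arguments sandw {R T U}.
Arguments psd {R T}.
Arguments is_state {R T}.
Arguments unitary {R T}.
Arguments tnorm {R T}.
Arguments tp_kraus {R I T U}.
Arguments tpow {R A B}.
Arguments achievable {R A B A' B'}.
Arguments rate {R A B A' B'}.
Arguments swapop {R A B}.
Arguments psi_plus {R}.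
Arguments E_D {R A B}.
Arguments E_c {R A B}.
Arguments E_b {R A B}.
Arguments sym_ent {R A B}.
Arguments asym_ent {R A B}.
Arguments separable {R A B}.
Arguments entangled {R A B}.

(* Main.v *)
Require Import Defs.
From HB Require Import structures.
From mathcomp Require Import all_boot all_order all_algebra.
From mathcomp Require Import spectral complex.
From mathcomp Require Import all_classical all_reals all_analysis.
From mathcomp Require Import ring lra.

(** Rates multiply along a chain of transformations, and the maximally entangled
    state psi_+ is invariant under the swap. Hence
    R(rho -> psi) R(psi -> rho) <= R(rho -> V rho V) and
    R(psi -> rho) R(rho -> V rho V) <= R(psi -> rho), which gives everything once
    0 < R(psi -> rho) < +oo. Positivity is teleportation.

    Finiteness says that entangled states have positive cost. An entangled rho is
    separated from the product vectors by an informationally complete local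
    measurement: there is a weight g > 0 on the outcomes whose mean is at most 1 on
    every product vector, while the mean of 1 / g on rho is some a < 1. On m copies
    the test "the product of the weights is at least t ^ m", with 1 < t < 1 / a,
    accepts rho with probability at least 1 - (t a) ^ m. A product vector passes with
    probability at most t ^ -m, because measuring one copy of a product vector leaves
    a product vector, so any state obtained from n copies of psi by LOCC passes with
    probability at most 2 ^ n t ^ -m. *)

Set Implicit Arguments. Unset Strict Implicit. Unset Printing Implicit Defensive.
Import Order.TTheory GRing.Theory Num.Theory.
Import numFieldNormedType.Exports.
Local Open Scope classical_set_scope.
Local Open Scope ring_scope.
Local Open Scope complex_scope.

Local Notation Re := complex.Re.
Local Notation Im := complex.Im.
Local Notation normc := Normc.normc.

(** * Complex vectors and matrices *)

Section Modulus.
Variable R : realType.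
Local Notation C := R[i].
Implicit Types z : C.

Lemma normc_ge0 z : 0 <= normc z.
Proof. exact: (normr_ge0 (z : Rcomplex R)). Qed.

Lemma normc_sum (I : Type) (s : seq I) (P : pred I) (F : I -> C) :
  normc (\sum_(i <- s | P i) F i) <= \sum_(i <- s | P i) normc (F i).
Proof. exact: (@ler_norm_sum R (Rcomplex R)). Qed.

Lemma normc_real (x : R) : normc x%:C = `|x|.
Proof. by rewrite /= expr0n addr0 sqrtr_sqr. Qed.

Lemma mulcJ z : z * conjc z = (normc z ^+ 2)%:C.
Proof. by rewrite -sqr_normc rmorphXn. Qed.

Lemma mulJc z : conjc z * z = (normc z ^+ 2)%:C.
Proof. by rewrite mulrC mulcJ. Qed.

Lemma normc_conj z : normc (conjc z) = normc z.
Proof. by apply: complexI; exact: normcJ. Qed.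

Lemma sqr_normcE z : normc z ^+ 2 = Re z ^+ 2 + Im z ^+ 2.
Proof. by case: z => a b /=; rewrite sqr_sqrtr// addr_ge0 ?sqr_ge0. Qed.

Lemma Re_le_normc z : `|Re z| <= normc z.
Proof. by rewrite -lecR; exact: normc_ge_Re. Qed.

Lemma Re_sum (I : Type) (s : seq I) (P : pred I) (F : I -> C) :
  Re (\sum_(i <- s | P i) F i) = \sum_(i <- s | P i) Re (F i).
Proof. exact: (raddf_sum (@complex.Re R : Rcomplex R -> R)). Qed.

Lemma Im_sum (I : Type) (s : seq I) (P : pred I) (F : I -> C) :
  Im (\sum_(i <- s | P i) F i) = \sum_(i <- s | P i) Im (F i).
Proof. exact: (raddf_sum (@complex.Im R : Rcomplex R -> R)). Qed.

Lemma mulr_le_mean_sqr (x y : R) : x * y <= (x ^+ 2 + y ^+ 2) / 2.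
Proof. by have := sqr_ge0 (x - y); lra. Qed.

Lemma sqr_sum_le (I : finType) (F : I -> R) :
  (\sum_i F i) ^+ 2 <= #|I|%:R * \sum_i F i ^+ 2.
Proof.
rewrite expr2 mulr_suml.
apply: (@le_trans _ _ (\sum_i \sum_j (F i ^+ 2 + F j ^+ 2) / 2)).
  by apply: ler_sum => i _; rewrite mulr_sumr ler_sum// => j _; exact: mulr_le_mean_sqr.
under eq_bigr do rewrite -mulr_suml big_split sumr_const /=.
rewrite -mulr_suml big_split sumr_const sumrMnl /= -mulrnDl -[X in X / 2]mulr_natl.
by rewrite -mulrA mulrDl -splitr.
Qed.

Lemma sqr_normc_sum_le (I : finType) (F : I -> C) :
  normc (\sum_i F i) ^+ 2 <= #|I|%:R * \sum_i normc (F i) ^+ 2.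
Proof.
apply: le_trans (sqr_sum_le _).
by rewrite lerXn2r ?nnegrE ?normc_ge0 ?normc_sum ?sumr_ge0// => i _; exact: normc_ge0.
Qed.

End Modulus.

Lemma sum_pair (V : nmodType) (T U : finType) (F : T * U -> V) :
  \sum_p F p = \sum_i \sum_j F (i, j).
Proof. by rewrite pair_bigA; apply: eq_bigr => -[]. Qed.

Lemma sum_unit (V : nmodType) (F : unit -> V) : \sum_i F i = F tt.
Proof. by rewrite (big_pred1 tt)// => -[]. Qed.

Lemma sum_delta (V : pzSemiRingType) (T : finType) (x : T) (F : T -> V) :
  \sum_y (x == y)%:R * F y = F x.
Proof.
rewrite (bigD1 x) //= eqxx mul1r big1 ?addr0// => y.
by rewrite eq_sym => /negPf ->; rewrite mul0r.
Qed.

Lemma natr_pair_eq (V : pzSemiRingType) (T U : eqType) (p q : T * U) :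
  (p == q)%:R = (p.1 == q.1)%:R * (p.2 == q.2)%:R :> V.
Proof. by rewrite -natrM mulnb. Qed.

HB.instance Definition _ (R : realType) (T U : finType) :=
  GRing.Lmodule.copy (mat R T U) (T -> U -> R[i]).

Section Matrices.
Variable R : realType.
Local Notation C := R[i].
Local Notation mat := (mat R).
Implicit Types T U V W : finType.

Lemma eq_mat T U (X Y : mat T U) : (forall i j, X i j = Y i j) -> X = Y.
Proof. by move=> XY; apply/funext => i; apply/funext => j. Qed.

Lemma sum_matE T U (I : Type) (s : seq I) (P : pred I) (X : I -> mat T U) i j :
  (\sum_(k <- s | P k) X k) i j = \sum_(k <- s | P k) X k i j.
Proof. by rewrite !fct_sumE. Qed.

Fact mulm_is_linear T U V (X : mat T U) :
  linear (mulm X : mat U V -> mat T V).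
Proof.
move=> c Y Z; apply: eq_mat => i j; rewrite /mulm.
by under eq_bigr do rewrite mulrDr mulrCA; rewrite big_split -mulr_sumr.
Qed.
HB.instance Definition _ T U V (X : mat T U) :=
  GRing.isLinear.Build C (mat U V) (mat T V) *:%R (mulm X) (@mulm_is_linear T U V X).

Fact adjm_is_additive T U : zmod_morphism (adjm : mat T U -> mat U T).
Proof. by move=> X Y; apply: eq_mat => i j; exact: rmorphB. Qed.
HB.instance Definition _ T U :=
  GRing.isZmodMorphism.Build (mat T U) (mat U T) adjm (@adjm_is_additive T U).

Fact trm_is_scalar T : scalar (trm : mat T T -> C).
Proof. by move=> c X Y; rewrite /trm mulr_sumr -big_split. Qed.
HB.instance Definition _ T :=
  GRing.isLinear.Build C (mat T T) C *%R trm (@trm_is_scalar T).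

Lemma adjmK T U (X : mat T U) : adjm (adjm X) = X.
Proof. by apply: eq_mat => i j; exact: conjcK. Qed.

Lemma adjmZ T U c (X : mat T U) : adjm (c *: X) = conjc c *: adjm X.
Proof. by apply: eq_mat => i j; exact: rmorphM. Qed.

Lemma adjm_mulm T U V (X : mat T U) (Y : mat U V) :
  adjm (mulm X Y) = mulm (adjm Y) (adjm X).
Proof.
apply: eq_mat => i j; rewrite /mulm /adjm rmorph_sum.
by apply: eq_bigr => k _; rewrite rmorphM mulrC.
Qed.

Lemma adjm1 T : adjm (idm T) = idm T :> mat T T.
Proof. by apply: eq_mat => i j; rewrite /adjm /idm conjc_nat eq_sym. Qed.

Lemma mulmA T U V W (X : mat T U) (Y : mat U V) (Z : mat V W) :
  mulm X (mulm Y Z) = mulm (mulm X Y) Z.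
Proof.
apply: eq_mat => i j; rewrite /mulm; under eq_bigr do rewrite mulr_sumr.
rewrite exchange_big; apply: eq_bigr => k _; rewrite mulr_suml.
by apply: eq_bigr => l _; rewrite mulrA.
Qed.

Lemma mul1m T U (X : mat T U) : mulm (idm T) X = X.
Proof. by apply: eq_mat => i j; exact: (sum_delta i (X^~ j)). Qed.

Lemma mulm1 T U (X : mat T U) : mulm X (idm U) = X.
Proof. by rewrite -[LHS]adjmK adjm_mulm adjm1 mul1m adjmK. Qed.

Definition mulmr T U V (Y : mat U V) (X : mat T U) : mat T V := mulm X Y.

Fact mulmr_is_linear T U V (Y : mat U V) : linear (mulmr Y : mat T U -> mat T V).
Proof.
move=> c X Z; apply: eq_mat => i j; rewrite /mulmr /mulm.
by under eq_bigr do rewrite mulrDl -mulrA; rewrite big_split -mulr_sumr.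
Qed.
HB.instance Definition _ T U V (Y : mat U V) :=
  GRing.isLinear.Build C (mat T U) (mat T V) *:%R (mulmr Y) (@mulmr_is_linear T U V Y).

Lemma scale_mulml T U V c (X : mat T U) (Y : mat U V) :
  mulm (c *: X) Y = c *: mulm X Y.
Proof. exact: (linearZ_LR (mulmr Y)). Qed.

Lemma mulm_suml T U V (I : Type) (s : seq I) (P : pred I) (X : I -> mat T U)
    (Y : mat U V) :
  mulm (\sum_(k <- s | P k) X k) Y = \sum_(k <- s | P k) mulm (X k) Y.
Proof. exact: (linear_sum (mulmr Y)). Qed.

Lemma trm_mulmC T U (X : mat T U) (Y : mat U T) : trm (mulm X Y) = trm (mulm Y X).
Proof.
by rewrite /trm /mulm exchange_big; do 2 apply: eq_bigr => ? _; rewrite mulrC.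
Qed.

Lemma trm1_inhabited T (X : mat T T) : trm X = 1 -> inhabited T.
Proof.
move=> X1; suff /card_gt0P[x _] : (0 < #|T|)%N by exists.
rewrite lt0n; apply: contra_eqN X1 => /eqP T0.
by rewrite /trm big_pred0 1?eq_sym ?oner_neq0// => x; have := fintype0 x T0.
Qed.

Fact sandw_is_linear T U (K : mat T U) : linear (sandw K).
Proof. exact: (linearP (mulmr (adjm K) \o mulm K)). Qed.
HB.instance Definition _ T U (K : mat T U) :=
  GRing.isLinear.Build C (mat U U) (mat T T) *:%R (sandw K) (sandw_is_linear K).

Definition herm T (X : mat T T) : Prop := adjm X = X.

Lemma hermD T (X Y : mat T T) : herm X -> herm Y -> herm (X + Y).
Proof. by move=> hX hY; rewrite /herm raddfD /= hX hY. Qed.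

Lemma hermB T (X Y : mat T T) : herm X -> herm Y -> herm (X - Y).
Proof. by move=> hX hY; rewrite /herm raddfB /= hX hY. Qed.

Lemma herm_sum T (I : Type) (s : seq I) (X : I -> mat T T) :
  (forall k, herm (X k)) -> herm (\sum_(k <- s) X k).
Proof. by move=> hX; rewrite /herm raddf_sum; apply: eq_bigr => k _; exact: hX. Qed.

Lemma herm_sandw T U (K : mat T U) X : herm X -> herm (sandw K X).
Proof. by move=> hX; rewrite /herm /sandw !adjm_mulm adjmK hX mulmA. Qed.

End Matrices.

Section Vectors.
Variable R : realType.
Local Notation C := R[i].
Local Notation mat := (mat R).
Implicit Types T U V : finType.

Definition dot T (u w : T -> C) : C := \sum_i conjc (u i) * w i.

Definition sqnorm T (w : T -> C) : R := \sum_i normc (w i) ^+ 2.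

Definition mulmv T U (X : mat T U) (w : U -> C) : T -> C :=
  fun i => \sum_j X i j * w j.

Definition qform T (w : T -> C) (X : mat T T) : C := dot w (mulmv X w).

Definition ketbra T U (u : T -> C) (w : U -> C) : mat T U :=
  fun i j => u i * conjc (w j).

Definition basisv T (t : T) : T -> C := fun i => (i == t)%:R.

Fact dot_is_scalar T (u : T -> C) : scalar (dot u).
Proof.
move=> c v w; rewrite /dot mulr_sumr -big_split; apply: eq_bigr => i _.
by rewrite mulrDr mulrCA.
Qed.
HB.instance Definition _ T (u : T -> C) :=
  GRing.isLinear.Build C (T -> C) C *%R (dot u) (dot_is_scalar u).

Lemma conjc_dot T (u w : T -> C) : conjc (dot u w) = dot w u.
Proof.
by rewrite rmorph_sum; apply: eq_bigr => i _; rewrite rmorphM /= conjcK mulrC.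
Qed.

Lemma normc_dotC T (u w : T -> C) : normc (dot u w) = normc (dot w u).
Proof. by rewrite -conjc_dot normc_conj. Qed.

Lemma dot_self T (w : T -> C) : dot w w = (sqnorm w)%:C.
Proof. by rewrite rmorph_sum; apply: eq_bigr => i _; rewrite mulJc. Qed.

Lemma sqnorm_ge0 T (w : T -> C) : 0 <= sqnorm w.
Proof. by rewrite sumr_ge0// => i _; rewrite sqr_ge0. Qed.

Lemma sqnorm_eq0 T (w : T -> C) : sqnorm w = 0 -> w = 0.
Proof.
move=> w0; apply/funext => i; apply: Normc.eq0_normc; apply/eqP.
by rewrite -sqrf_eq0 (psumr_eq0P _ w0)// => j _; exact: sqr_ge0.
Qed.

Lemma sqnormZ T c (w : T -> C) : sqnorm (c *: w) = normc c ^+ 2 * sqnorm w.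
Proof. by rewrite mulr_sumr; apply: eq_bigr => i _; rewrite Normc.normcM exprMn. Qed.

Lemma normc_dot_le T (u w : T -> C) : normc (dot u w) <= (sqnorm u + sqnorm w) / 2.
Proof.
rewrite (le_trans (normc_sum _ _ _))// -big_split mulr_suml.
apply: ler_sum => i _; rewrite Normc.normcM normc_conj; exact: mulr_le_mean_sqr.
Qed.

Lemma dot_basisl T (t : T) w : dot (basisv t) w = w t.
Proof.
rewrite -[RHS](sum_delta t w); apply: eq_bigr => i _.
by rewrite /basisv conjc_nat eq_sym.
Qed.

Lemma sqnorm_basisv T (t : T) : sqnorm (basisv t) = 1.
Proof. by apply: complexI; rewrite -dot_self dot_basisl /basisv eqxx. Qed.

Lemma mulmv_basis T U (X : mat T U) t : mulmv X (basisv t) = X ^~ t.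
Proof.
apply/funext => i; rewrite -[RHS](sum_delta t (X i)).
by apply: eq_bigr => j _; rewrite mulrC eq_sym.
Qed.

Lemma dot_mulmv T U (X : mat T U) u w : dot u (mulmv X w) = dot (mulmv (adjm X) u) w.
Proof.
rewrite /dot /mulmv; under eq_bigr do rewrite mulr_sumr.
rewrite exchange_big; apply: eq_bigr => j _; rewrite rmorph_sum mulr_suml.
by apply: eq_bigr => i _; rewrite /adjm rmorphM /= conjcK mulrA [conjc _ * _]mulrC.
Qed.

Fact mulmv_is_linear T U (X : mat T U) : linear (mulmv X).
Proof.
move=> c v w; apply/funext => i; rewrite /mulmv.
by under eq_bigr do rewrite mulrDr mulrCA; rewrite big_split -mulr_sumr.
Qed.
HB.instance Definition _ T U (X : mat T U) :=
  GRing.isLinear.Build C (U -> C) (T -> C) *:%R (mulmv X) (mulmv_is_linear X).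

Lemma mulmvA T U V (X : mat T U) (Y : mat U V) w :
  mulmv X (mulmv Y w) = mulmv (mulm X Y) w.
Proof.
apply/funext => i; rewrite /mulmv /mulm; under eq_bigr do rewrite mulr_sumr.
rewrite exchange_big; apply: eq_bigr => j _; rewrite mulr_suml.
by apply: eq_bigr => k _; rewrite mulrA.
Qed.

Lemma mul1mv T (w : T -> C) : mulmv (idm T) w = w.
Proof. by apply/funext => i; exact: sum_delta. Qed.

Lemma qformE T (X : mat T T) w :
  qform w X = \sum_i \sum_j conjc (w i) * X i j * w j.
Proof.
apply: eq_bigr => i _; rewrite mulr_sumr.
by apply: eq_bigr => j _; rewrite mulrA.
Qed.

Fact qform_is_scalar T (w : T -> C) : scalar (qform w).
Proof.
move=> c X Y; rewrite /qform -linearP; congr dot; apply/funext => i.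
rewrite /mulmv; under eq_bigr do rewrite mulrDl -mulrA.
by rewrite big_split -mulr_sumr.
Qed.
HB.instance Definition _ T (w : T -> C) :=
  GRing.isLinear.Build C (mat T T) C *%R (qform w) (qform_is_scalar w).

Lemma qform1 T (w : T -> C) : qform w (idm T) = (sqnorm w)%:C.
Proof. by rewrite /qform mul1mv dot_self. Qed.

Lemma qform_sandw T U (K : mat T U) X w :
  qform w (sandw K X) = qform (mulmv (adjm K) w) X.
Proof. by rewrite /qform /sandw -!mulmvA dot_mulmv. Qed.

Lemma qform_adjm T (X : mat T T) w : qform w (adjm X) = conjc (qform w X).
Proof. by rewrite /qform conjc_dot dot_mulmv adjmK. Qed.

Lemma sqnorm_mulmv T U (K : mat T U) w :
  (sqnorm (mulmv K w))%:C = qform w (mulm (adjm K) K).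
Proof. by rewrite /qform -mulmvA dot_mulmv adjmK dot_self. Qed.

Lemma adjm_ketbra T U (u : T -> C) (w : U -> C) : adjm (ketbra u w) = ketbra w u.
Proof. by apply: eq_mat => i j; rewrite /adjm rmorphM /= conjcK mulrC. Qed.

Lemma mulm_ketbra T U V (K : mat T U) u (w : V -> C) :
  mulm K (ketbra u w) = ketbra (mulmv K u) w.
Proof.
apply: eq_mat => i j; rewrite [RHS]mulr_suml.
by apply: eq_bigr => k _; rewrite mulrA.
Qed.

Lemma mulmv_ketbra T U (u : T -> C) (w v : U -> C) :
  mulmv (ketbra u w) v = dot w v *: u.
Proof.
apply/funext => i; rewrite [RHS]mulr_suml; apply: eq_bigr => j _.
by rewrite /ketbra -mulrA mulrC.
Qed.

Lemma ketbraZl T U c (u : T -> C) (w : U -> C) : ketbra (c *: u) w = c *: ketbra u w.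
Proof. by apply: eq_mat => i j; exact/esym/mulrA. Qed.

Lemma ketbraZ T c (u : T -> C) :
  ketbra (c *: u) (c *: u) = (normc c ^+ 2)%:C *: ketbra u u.
Proof.
by rewrite ketbraZl -[ketbra u _]adjmK adjm_ketbra ketbraZl adjmZ adjm_ketbra scalerA
  mulcJ.
Qed.

Lemma ketbra_sqrtZ T r (u : T -> C) : 0 <= r ->
  ketbra ((Num.sqrt r)%:C *: u) ((Num.sqrt r)%:C *: u) = r%:C *: ketbra u u.
Proof. by move=> r0; rewrite ketbraZ normc_real real_normK ?num_real ?sqr_sqrtr. Qed.

Lemma sum_ketbra_basis T : \sum_t ketbra (basisv t) (basisv t) = idm T :> mat T T.
Proof.
apply: eq_mat => i j; rewrite sum_matE -[RHS](sum_delta i (fun t => (t == j)%:R)).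
by apply: eq_bigr => t _; rewrite /ketbra /basisv conjc_nat [t == j]eq_sym.
Qed.

Lemma mulm_ketbra2 T U V (u : T -> C) (w w' : U -> C) (v : V -> C) :
  mulm (ketbra u w) (ketbra w' v) = dot w w' *: ketbra u v.
Proof. by rewrite mulm_ketbra mulmv_ketbra ketbraZl. Qed.

Lemma sandw_ketbra T U (K : mat T U) w :
  sandw K (ketbra w w) = ketbra (mulmv K w) (mulmv K w).
Proof.
by rewrite /sandw mulm_ketbra -[LHS]adjmK adjm_mulm adjmK adjm_ketbra mulm_ketbra
  adjm_ketbra.
Qed.

Lemma trm_ketbra T (u w : T -> C) : trm (ketbra u w) = dot w u.
Proof. by apply: eq_bigr => i _; rewrite mulrC. Qed.

Lemma trm_mulm_ketbra T (X : mat T T) u w :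
  trm (mulm X (ketbra u w)) = dot w (mulmv X u).
Proof. by rewrite mulm_ketbra trm_ketbra. Qed.

Lemma qform_ketbra T (u w : T -> C) :
  qform w (ketbra u u) = (normc (dot w u) ^+ 2)%:C.
Proof. by rewrite /qform mulmv_ketbra linearZ /= -(conjc_dot w) mulJc. Qed.

End Vectors.

Section TensorProducts.
Variable R : realType.
Local Notation C := R[i].
Local Notation mat := (mat R).
Implicit Types T U V : finType.

Definition kronv T U (a : T -> C) (b : U -> C) : T * U -> C :=
  fun p => a p.1 * b p.2.

Lemma adjm_kron T U T' U' (X : mat T U) (Y : mat T' U') :
  adjm (kron X Y) = kron (adjm X) (adjm Y).
Proof. by apply: eq_mat => i j; exact: rmorphM. Qed.

Lemma mulm_kron T U V T' U' V' (X : mat T U) (Y : mat U V)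
    (X' : mat T' U') (Y' : mat U' V') :
  mulm (kron X X') (kron Y Y') = kron (mulm X Y) (mulm X' Y').
Proof.
apply: eq_mat => i j; rewrite /mulm /kron sum_pair mulr_suml.
by apply: eq_bigr => k _; rewrite mulr_sumr; apply: eq_bigr => l _; rewrite mulrACA.
Qed.

Lemma kron1 T U : kron (idm T) (idm U) = idm (T * U)%type :> mat _ _.
Proof. by apply: eq_mat => i j; rewrite /idm natr_pair_eq. Qed.

Lemma kron_suml T U T' U' (I : finType) (X : I -> mat T U) (Y : mat T' U') :
  kron (\sum_i X i) Y = \sum_i kron (X i) Y.
Proof.
by apply: eq_mat => i j; rewrite /kron !sum_matE mulr_suml.
Qed.

Lemma kron_sumr T U T' U' (I : finType) (X : mat T U) (Y : I -> mat T' U') :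
  kron X (\sum_i Y i) = \sum_i kron X (Y i).
Proof.
by apply: eq_mat => i j; rewrite /kron !sum_matE mulr_sumr.
Qed.

Lemma dot_kronv T U (a a' : T -> C) (b b' : U -> C) :
  dot (kronv a b) (kronv a' b') = dot a a' * dot b b'.
Proof.
rewrite /dot sum_pair mulr_suml; apply: eq_bigr => i _; rewrite mulr_sumr.
by apply: eq_bigr => j _; rewrite /kronv rmorphM mulrACA.
Qed.

Lemma sqnorm_kronv T U (a : T -> C) (b : U -> C) :
  sqnorm (kronv a b) = sqnorm a * sqnorm b.
Proof. by apply: complexI; rewrite rmorphM /= -!dot_self dot_kronv. Qed.

Lemma mulmv_kron T U T' U' (X : mat T U) (Y : mat T' U') a b :
  mulmv (kron X Y) (kronv a b) = kronv (mulmv X a) (mulmv Y b).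
Proof.
apply/funext => i; rewrite /mulmv sum_pair /kronv mulr_suml; apply: eq_bigr => j _.
by rewrite mulr_sumr; apply: eq_bigr => k _; rewrite mulrACA.
Qed.

Lemma ketbra_kronv T U T' U' (a : T -> C) (b : U -> C) (a' : T' -> C) (b' : U' -> C) :
  ketbra (kronv a b) (kronv a' b') = kron (ketbra a a') (ketbra b b').
Proof. by apply: eq_mat => i j; rewrite /ketbra /kronv rmorphM mulrACA. Qed.

Lemma basisv_pair T U (p : T * U) :
  basisv R p = kronv (basisv R p.1) (basisv R p.2).
Proof. by apply/funext => q; exact: natr_pair_eq. Qed.

End TensorProducts.

(** * Measurement frames *)

Section Frames.
Variable R : realType.
Local Notation C := R[i].
Local Notation mat := (mat R).
Implicit Types T U X Y Z : finType.

Definition parseval_frame X T (v : X -> T -> C) : Prop :=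
  \sum_x ketbra (v x) (v x) = idm T.

Definition infocomplete X T (v : X -> T -> C) : Prop :=
  forall i j : T, exists c : X -> C,
    ketbra (basisv R i) (basisv R j) = \sum_x c x *: ketbra (v x) (v x).

Definition kron_frame X T Y U (v : X -> T -> C) (u : Y -> U -> C) :
  X * Y -> T * U -> C := fun z => kronv (v z.1) (u z.2).

Definition outcome Z T (V : Z -> T -> C) (M : mat T T) (z : Z) : R :=
  Re (qform (V z) M).

Definition born Z T (V : Z -> T -> C) (w : T -> C) (z : Z) : R :=
  normc (dot (V z) w) ^+ 2.

Lemma sum_qform_frame X T (v : X -> T -> C) (M : mat T T) : parseval_frame v ->
  \sum_x qform (v x) M = trm M.
Proof.
move=> v1; rewrite -[M in RHS]mulm1 -v1 !linear_sum; apply: eq_bigr => x _ /=.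
by rewrite trm_mulm_ketbra.
Qed.

Lemma born_ge0 Z T (V : Z -> T -> C) w z : 0 <= born V w z.
Proof. exact: sqr_ge0. Qed.

Lemma sum_born Z T (V : Z -> T -> C) w : parseval_frame V ->
  \sum_z born V w z = sqnorm w.
Proof.
move=> V1; apply: complexI; rewrite -[RHS]dot_self -trm_ketbra -(sum_qform_frame _ V1).
by rewrite rmorph_sum; apply: eq_bigr => z _; rewrite qform_ketbra.
Qed.

Lemma parseval_frame_kron X T Y U (v : X -> T -> C) (u : Y -> U -> C) :
  parseval_frame v -> parseval_frame u -> parseval_frame (kron_frame v u).
Proof.
move=> v1 u1; rewrite /parseval_frame -kron1 -v1 -u1 kron_suml sum_pair.
by apply: eq_bigr => x _; rewrite kron_sumr; apply: eq_bigr => y _; exact: ketbra_kronv.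
Qed.

Lemma infocomplete_kron X T Y U (v : X -> T -> C) (u : Y -> U -> C) :
  infocomplete v -> infocomplete u -> infocomplete (kron_frame v u).
Proof.
move=> hv hu p q; have [c ec] := hv p.1 q.1; have [d ed] := hu p.2 q.2.
exists (fun z => c z.1 * d z.2); rewrite !basisv_pair ketbra_kronv ec ed.
rewrite kron_suml sum_pair; apply: eq_bigr => x _; rewrite kron_sumr.
apply: eq_bigr => y _; rewrite /kron_frame ketbra_kronv.
by apply: eq_mat => i j; exact: mulrACA.
Qed.

Lemma infocomplete_eq0 X T (v : X -> T -> C) (M : mat T T) : infocomplete v ->
  (forall x, qform (v x) M = 0) -> M = 0.
Proof.
move=> hv hM; apply: eq_mat => i j; have [c ec] := hv j i.
transitivity (trm (mulm M (ketbra (basisv R j) (basisv R i)))).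
  by rewrite trm_mulm_ketbra dot_basisl mulmv_basis.
rewrite ec !linear_sum big1// => x _.
by rewrite !linearZ /= trm_mulm_ketbra -/(qform _ _) hM mulr0.
Qed.

(* Averaging the phases [i ^ s] isolates the off-diagonal terms: polarisation. *)
Definition polar_vec T (x : T * T * 'I_4) : T -> C :=
  basisv R x.1.1 + 'i ^+ x.2 *: basisv R x.1.2.

Lemma ketbra_phaseE T (u w : T -> C) s i j :
  ketbra (u + 'i ^+ s *: w) (u + 'i ^+ s *: w) i j
  = (u i + 'i ^+ s * w i) * (conjc (u j) + (- 'i) ^+ s * conjc (w j)).
Proof.
have -> : - 'i = conjc 'i :> C by congr Complex; rewrite oppr0.
rewrite -[conjc 'i ^+ s]rmorphXn /=; congr (_ * _).
by rewrite -rmorphM; exact: rmorphD.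
Qed.

Lemma mul_ii : 'i * 'i = -1 :> C.
Proof. by rewrite -expr2 sqr_i. Qed.

Lemma ketbra_phase_sum T (u w : T -> C) :
  \sum_(s < 4) ketbra (u + 'i ^+ s *: w) (u + 'i ^+ s *: w)
  = 4 *: (ketbra u u + ketbra w w).
Proof.
apply: eq_mat => i j; rewrite sum_matE; under eq_bigr do rewrite ketbra_phaseE.
transitivity (4 * (u i * conjc (u j) + w i * conjc (w j))) => //.
rewrite !big_ord_recr big_ord0 /=; ring: mul_ii.
Qed.

Lemma ketbra_phase_sum_twisted T (u w : T -> C) :
  \sum_(s < 4) 'i ^+ s *: ketbra (u + 'i ^+ s *: w) (u + 'i ^+ s *: w)
  = 4 *: ketbra u w.
Proof.
apply: eq_mat => i j; rewrite sum_matE.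
transitivity (\sum_(s < 4) 'i ^+ s *
    ((u i + 'i ^+ s * w i) * (conjc (u j) + (- 'i) ^+ s * conjc (w j)))).
  by apply: eq_bigr => s _; rewrite -ketbra_phaseE.
transitivity (4 * (u i * conjc (w j))) => //.
rewrite !big_ord_recr big_ord0 /=; ring: mul_ii.
Qed.

Definition polar_frame T (x : T * T * 'I_4) : T -> C :=
  (Num.sqrt ((8 * #|T|)%:R^-1))%:C *: polar_vec x.

Lemma ketbra_polar_frame T (x : T * T * 'I_4) :
  ketbra (polar_frame x) (polar_frame x)
  = (8 * #|T|)%:R^-1 *: ketbra (polar_vec x) (polar_vec x).
Proof. by rewrite ketbra_sqrtZ ?invr_ge0// fmorphV rmorph_nat. Qed.

Lemma parseval_polar_frame T : parseval_frame (@polar_frame T).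
Proof.
rewrite /parseval_frame; under eq_bigr do rewrite ketbra_polar_frame.
rewrite -scaler_sumr !sum_pair.
under eq_bigr do under eq_bigr do rewrite /polar_vec /= ketbra_phase_sum.
under eq_bigr do rewrite -scaler_sumr big_split /= sum_ketbra_basis sumr_const.
rewrite -scaler_sumr big_split /= sumr_const sumrMnl sum_ketbra_basis -mulrnDl.
apply: eq_mat => i j; have T0 : #|T|%:R != 0 :> C.
  by rewrite pnatr_eq0 -lt0n; apply/card_gt0P; exists i.
rewrite -mulr2n -mulrnA -[idm T *+ _]scaler_nat !scalerA !natrM.
rewrite [X in X *: _](_ : _ = 1) ?scale1r//.
by field.
Qed.

Lemma infocomplete_polar_frame T : infocomplete (@polar_frame T).
Proof.
move=> i j; have T0 : #|T|%:R != 0 :> C.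
  by rewrite pnatr_eq0 -lt0n; apply/card_gt0P; exists i.
exists (fun x : T * T * 'I_4 => ((i, j) == x.1)%:R * (2 * #|T|%:R * 'i ^+ x.2)).
rewrite sum_pair (bigD1 (i, j)) //= [X in _ + X]big1 => [|p ij]; last first.
  by rewrite big1// => s _; rewrite eq_sym (negPf ij) mul0r scale0r.
under eq_bigr do rewrite eqxx mul1r ketbra_polar_frame scalerA mulrAC -scalerA.
rewrite /polar_vec -scaler_sumr /= ketbra_phase_sum_twisted addr0 scalerA.
rewrite natrM [X in X *: _](_ : _ = 1) ?scale1r//.
by field.
Qed.

End Frames.

Lemma psd_qform_ge0 (R : realType) (T : finType) (X : mat R T T) w :
  psd X -> 0 <= qform w X.
Proof. by move=> X0; rewrite qformE; exact: X0. Qed.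

Lemma psd_herm (R : realType) (T : finType) (X : mat R T T) : psd X -> herm X.
Proof.
move=> X0; apply/subr0_eq/(infocomplete_eq0 (@infocomplete_polar_frame R T)) => x.
rewrite linearB /= qform_adjm -(RRe_real (ger0_real (psd_qform_ge0 _ X0))).
by rewrite conjc_real subrr.
Qed.

(** * The trace norm of Hermitian matrices *)

Section TraceNorm.
Variable R : realType.
Local Notation C := R[i].
Local Notation mat := (mat R).
Implicit Types T : finType.

Definition orthonormal T (e : T -> T -> C) : Prop :=
  forall k l, dot (e k) (e l) = (k == l)%:R.

Lemma qform_orthonormal_sum T (e : T -> T -> C) (c : T -> C) k : orthonormal e ->
  qform (e k) (\sum_l c l *: ketbra (e l) (e l)) = c k.
Proof.
move=> orth; rewrite linear_sum -[RHS](sum_delta k c); apply: eq_bigr => l _.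
rewrite linearZ /= qform_ketbra orth mulrC; case: (k == l).
  by rewrite Normc.normc1 expr1n.
by rewrite Normc.normc0 expr0n.
Qed.

Lemma spectral_theorem T (X : mat T T) : herm X ->
  exists (e : T -> T -> C) (d : T -> R),
    [/\ orthonormal e,
        \sum_k ketbra (e k) (e k) = idm T
      & X = \sum_k (d k)%:C *: ketbra (e k) (e k)].
Proof.
move=> hX; pose A : 'M[C]_#|T| := \matrix_(i, j) X (enum_val i) (enum_val j).
have hA : A \is hermsymmx.
  apply/is_hermitianmxP; rewrite expr0 scale1r; apply/matrixP => i j.
  by rewrite !mxE -[in LHS]hX.
have /orthomx_spectralP := hermitian_normalmx hA.
have hP := spectral_unitarymx A; have hD := hermitian_spectral_diag_real hA.
rewrite invmx_unitary//; set P := spectralmx A in hP *.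
set D := spectral_diag A in hD * => eA.
have PPt := unitarymxP hP; have PtP := mulmx1C PPt.
have sum_enum (F : 'I_#|T| -> C) : \sum_i F i = \sum_(x : T) F (enum_rank x).
  by rewrite (reindex (@enum_rank T)) //; exact: onW_bij (enum_rank_bij T).
exists (fun k i => conjc (P (enum_rank k) (enum_rank i))).
exists (fun k => Re (D 0 (enum_rank k))); split.
- move=> k l; have /matrixP/(_ (enum_rank k) (enum_rank l)) := PPt.
  rewrite !mxE sum_enum (inj_eq enum_rank_inj) => <-; apply: eq_bigr => i _.
  by rewrite !mxE conjcK.
- apply: eq_mat => i j; have /matrixP/(_ (enum_rank i) (enum_rank j)) := PtP.
  rewrite !mxE sum_enum (inj_eq enum_rank_inj) sum_matE /idm => <-;
    apply: eq_bigr => k _.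
  by rewrite !mxE /ketbra conjcK.
- apply: eq_mat => i j; have /matrixP/(_ (enum_rank i) (enum_rank j)) := eA.
  rewrite !mxE !enum_rankK sum_enum sum_matE => ->; apply: eq_bigr => k _.
  rewrite mul_mx_diag !mxE RRe_real; last by have /mxOverP := hD; apply.
  by rewrite mulrAC mulrC -[P _ (enum_rank j)]conjcK.
Qed.

Lemma psd_sum_ketbra T (X : mat T T) : psd X ->
  exists phi : T -> T -> C, X = \sum_k ketbra (phi k) (phi k).
Proof.
move=> X0; have [e [d [orth _ eX]]] := spectral_theorem (psd_herm X0).
have d0 k : 0 <= d k.
  by rewrite -ler0c -(qform_orthonormal_sum (fun l => (d l)%:C) k orth) -eX
    psd_qform_ge0.
exists (fun k => (Num.sqrt (d k))%:C *: e k); rewrite [LHS]eX.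
by apply: eq_bigr => k _; rewrite ketbra_sqrtZ.
Qed.

(* Numerical radius at most one is all that trace norm duality needs and, unlike
   unitarity, it passes to the adjoint of a channel. *)
Definition numradius_le1 T (M : mat T T) : Prop :=
  forall w, normc (qform w M) <= sqnorm w.

Lemma numradius_unitary T (U : mat T T) : unitary U -> numradius_le1 U.
Proof.
move=> U1 w; have nUw : sqnorm (mulmv U w) = sqnorm w.
  by apply: complexI; rewrite sqnorm_mulmv U1 qform1.
by rewrite (le_trans (normc_dot_le _ _))// nUw mulrDl -splitr.
Qed.

Lemma unitary1 T : unitary (idm T : mat T T).
Proof. by rewrite /unitary mulm1 adjm1. Qed.

Lemma unitary_sign_ketbra T (e : T -> T -> C) (s : T -> R) :
  orthonormal e -> \sum_k ketbra (e k) (e k) = idm T ->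
  (forall k, s k ^+ 2 = 1) ->
  unitary (\sum_k (s k)%:C *: ketbra (e k) (e k)).
Proof.
move=> orth complete s2; rewrite /unitary -complete [adjm _]raddf_sum /= mulm_suml.
apply: eq_bigr => k _; rewrite linear_sum (bigD1 k)//= big1 => [|l lk];
  rewrite linearZ /= adjmZ adjm_ketbra scale_mulml mulm_ketbra2 orth.
  by rewrite eqxx addr0 scale1r scalerA mulcJ normc_real real_normK ?num_real// s2
    scale1r.
by rewrite eq_sym (negPf lk) scale0r !scaler0.
Qed.

Lemma herm_trace_norm_attained T (X : mat T T) : herm X ->
  exists2 U, unitary U & forall M, numradius_le1 M ->
    normc (trm (mulm M X)) <= normc (trm (mulm U X)).
Proof.
move=> /spectral_theorem[e [d [orth complete ->]]].
have trE M : trm (mulm M (\sum_k (d k)%:C *: ketbra (e k) (e k)))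
    = \sum_k (d k)%:C * qform (e k) M.
  by rewrite !linear_sum; apply: eq_bigr => k _; rewrite !linearZ /= trm_mulm_ketbra.
pose s k : R := if 0 <= d k then 1 else -1.
exists (\sum_k (s k)%:C *: ketbra (e k) (e k)) => [|M M1].
  by apply: unitary_sign_ketbra => // k; rewrite /s; case: ifP => _;
    rewrite ?sqrrN expr1n.
have -> : trm (mulm (\sum_k (s k)%:C *: ketbra (e k) (e k))
    (\sum_k (d k)%:C *: ketbra (e k) (e k))) = (\sum_k `|d k|)%:C.
  rewrite trE rmorph_sum; apply: eq_bigr => k _.
  rewrite (qform_orthonormal_sum (fun l => (s l)%:C)) // -rmorphM /s.
  by case: ger0P => _; rewrite ?mulr1 ?mulrN1.
rewrite trE normc_real ger0_norm ?sumr_ge0// (le_trans (normc_sum _ _ _))//.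
apply: ler_sum => k _; rewrite Normc.normcM normc_real ler_piMr// (le_trans (M1 _))//.
by rewrite -lecR -dot_self orth eqxx.
Qed.

Lemma tnorm_attained T (X : mat T T) : herm X ->
  (exists2 U, unitary U & normc (trm (mulm U X)) = tnorm X) /\
  forall M, numradius_le1 M -> normc (trm (mulm M X)) <= tnorm X.
Proof.
move=> /herm_trace_norm_attained[U U1 Umax].
suff tnE : normc (trm (mulm U X)) = tnorm X.
  by split=> [|M /Umax]; [exists U|rewrite tnE].
set S := [set normc (trm (mulm V X)) | V in unitary].
have S_ub : ubound S (normc (trm (mulm U X))).
  by move=> _ [V V1 <-]; apply/Umax/numradius_unitary.
have SU : S (normc (trm (mulm U X))) by exists U.
by apply/eqP; rewrite eq_le ub_le_sup ?ge_sup//; exists (normc (trm (mulm U X))).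
Qed.

Lemma le_tnorm T (X M : mat T T) : herm X -> numradius_le1 M ->
  normc (trm (mulm M X)) <= tnorm X.
Proof. by move=> /tnorm_attained[_]; exact. Qed.

Lemma tnorm_le T (X : mat T T) c : herm X ->
  (forall M, numradius_le1 M -> normc (trm (mulm M X)) <= c) -> tnorm X <= c.
Proof. by move=> /tnorm_attained[[U U1 <-] _]; apply; exact: numradius_unitary. Qed.

Lemma tnorm_ge0 T (X : mat T T) : herm X -> 0 <= tnorm X.
Proof.
by move=> /le_tnorm/(_ (numradius_unitary (unitary1 T)))/(le_trans _)->;
  rewrite ?normc_ge0.
Qed.

Lemma tnorm_subm_refl T (X : mat T T) : tnorm (subm X X) = 0.
Proof.
have -> : subm X X = 0 by exact: subrr.
have [|[U _ <-] _] := @tnorm_attained T 0; first exact: raddf0.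
by rewrite !linear0 Normc.normc0.
Qed.

Lemma tnormD T (X Y : mat T T) : herm X -> herm Y -> tnorm (X + Y) <= tnorm X + tnorm Y.
Proof.
move=> hX hY; apply: tnorm_le => [|M M1]; first exact: hermD.
by rewrite !linearD (le_trans (le_normcD _ _))// lerD// le_tnorm.
Qed.

End TraceNorm.

(** * LOCC channels *)

Section KrausMaps.
Variable R : realType.
Local Notation C := R[i].
Local Notation mat := (mat R).
Implicit Types T U V : finType.

Definition kraus T U (s : seq (mat T U)) (X : mat U U) : mat T T :=
  \sum_(K <- s) sandw K X.

Definition kraus_complete T U (s : seq (mat T U)) : Prop :=
  \sum_(K <- s) mulm (adjm K) K = idm U.

Fact kraus_is_linear T U (s : seq (mat T U)) : linear (kraus s).
Proof.
move=> c X Y; rewrite /kraus scaler_sumr -big_split.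
by apply: eq_bigr => K _; rewrite linearP.
Qed.
HB.instance Definition _ T U (s : seq (mat T U)) :=
  GRing.isLinear.Build C (mat U U) (mat T T) *:%R (kraus s) (kraus_is_linear s).

Lemma sandw_mulm T U V (K : mat T U) (L : mat U V) X :
  sandw (mulm K L) X = sandw K (sandw L X).
Proof. by rewrite /sandw adjm_mulm !mulmA. Qed.

Lemma trm_mulm_sandw T U (M : mat T T) (K : mat T U) X :
  trm (mulm M (sandw K X)) = trm (mulm (sandw (adjm K) M) X).
Proof. by rewrite /sandw adjmK !mulmA trm_mulmC !mulmA. Qed.

Lemma tp_krausP (I T U : finType) (K : I -> mat T U) :
  tp_kraus K <-> \sum_k mulm (adjm (K k)) (K k) = idm U.
Proof.
split=> [K1|K1 x y]; last by rewrite -K1 sum_matE.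
by apply: eq_mat => x y; rewrite sum_matE.
Qed.

Lemma sum_sqnorm_kraus T U (s : seq (mat T U)) w : kraus_complete s ->
  \sum_(K <- s) sqnorm (mulmv K w) = sqnorm w.
Proof.
move=> s1; apply: complexI; rewrite -[RHS]qform1 -s1 linear_sum rmorph_sum.
by apply: eq_bigr => K _; exact: sqnorm_mulmv.
Qed.

Lemma herm_kraus T U (s : seq (mat T U)) X : herm X -> herm (kraus s X).
Proof. by move=> hX; apply: herm_sum => K; exact: herm_sandw. Qed.

Lemma tnorm_kraus T U (s : seq (mat T U)) X : kraus_complete s -> herm X ->
  tnorm (kraus s X) <= tnorm X.
Proof.
move=> s1 hX; apply: tnorm_le => [|M M1]; first exact: herm_kraus.
have -> : trm (mulm M (kraus s X)) = trm (mulm (\sum_(K <- s) sandw (adjm K) M) X).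
  by rewrite mulm_suml !linear_sum; apply: eq_bigr => K _; exact: trm_mulm_sandw.
apply: le_tnorm => // w; rewrite linear_sum (le_trans (normc_sum _ _ _))//.
rewrite -(sum_sqnorm_kraus w s1); apply: ler_sum => K _.
by rewrite /= qform_sandw adjmK.
Qed.

End KrausMaps.

Section LOCCStructure.
Variable R : realType.
Local Notation mat := (mat R).
Local Notation bop := (bop R).
Implicit Types A B : finType.

Lemma sum_channelE T T1 U (I J : finType) (F : I -> J -> mat T T -> mat T1 T1)
    (Psi : I -> mat T1 T1 -> mat U U) :
  (fun X x y => \sum_i Psi i (fun u v => \sum_j F i j X u v) x y)
  = fun X => \sum_i Psi i (\sum_j F i j X).
Proof.
apply/funext => X; apply: eq_mat => x y; rewrite sum_matE; apply: eq_bigr => i _.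
by congr (Psi i _ x y); apply: eq_mat => u v; rewrite sum_matE.
Qed.

Lemma sum_sandwE T U (I J : finType) (K : I -> J -> mat U T) :
  (fun X x y => \sum_i \sum_j sandw (K i j) X x y)
  = fun X => \sum_i \sum_j sandw (K i j) X.
Proof.
apply/funext => X; apply: eq_mat => x y; rewrite sum_matE.
by apply: eq_bigr => i _; rewrite sum_matE.
Qed.

Lemma LOCC_local_sum A B A' B' (I J : finType) (K : I -> mat A' A) (L : J -> mat B' B) :
  tp_kraus K -> tp_kraus L ->
  LOCC (fun X => \sum_i \sum_j sandw (kron (K i) (L j)) X).
Proof.
move=> K1 L1; rewrite -(sum_sandwE (fun i j => kron (K i) (L j))).
exact: LOCC_local.
Qed.

Lemma LOCC_Alice_sum A B A1 A' B' (I J : finType) (K : I -> J -> mat A1 A)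
    (Psi : I -> bop A1 B -> bop A' B') :
  tp_kraus (fun ij : I * J => K ij.1 ij.2) -> (forall i, LOCC (Psi i)) ->
  LOCC (fun X => \sum_i Psi i (\sum_j sandw (kron (K i j) (idm B)) X)).
Proof.
move=> K1 PsiL; rewrite -(sum_channelE (fun i j => sandw (kron (K i j) (idm B)))).
exact: LOCC_Alice.
Qed.

Lemma LOCC_Bob_sum A B B1 A' B' (I J : finType) (L : I -> J -> mat B1 B)
    (Psi : I -> bop A B1 -> bop A' B') :
  tp_kraus (fun ij : I * J => L ij.1 ij.2) -> (forall i, LOCC (Psi i)) ->
  LOCC (fun X => \sum_i Psi i (\sum_j sandw (kron (idm A) (L i j)) X)).
Proof.
move=> L1 PsiL; rewrite -(sum_channelE (fun i j => sandw (kron (idm A) (L i j)))).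
exact: LOCC_Bob.
Qed.

Lemma LOCC_sum_ind
    (P : forall A B A' B' : finType, (bop A B -> bop A' B') -> Prop) :
  (forall (A B A' B' I J : finType) (K : I -> mat A' A) (L : J -> mat B' B),
    tp_kraus K -> tp_kraus L ->
    P _ _ _ _ (fun X => \sum_i \sum_j sandw (kron (K i) (L j)) X)) ->
  (forall (A B A1 A' B' I J : finType) (K : I -> J -> mat A1 A)
      (Psi : I -> bop A1 B -> bop A' B'),
    tp_kraus (fun ij : I * J => K ij.1 ij.2) ->
    (forall i, LOCC (Psi i)) -> (forall i, P _ _ _ _ (Psi i)) ->
    P _ _ _ _ (fun X => \sum_i Psi i (\sum_j sandw (kron (K i j) (idm B)) X))) ->
  (forall (A B B1 A' B' I J : finType) (L : I -> J -> mat B1 B)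
      (Psi : I -> bop A B1 -> bop A' B'),
    tp_kraus (fun ij : I * J => L ij.1 ij.2) ->
    (forall i, LOCC (Psi i)) -> (forall i, P _ _ _ _ (Psi i)) ->
    P _ _ _ _ (fun X => \sum_i Psi i (\sum_j sandw (kron (idm A) (L i j)) X))) ->
  forall (A B A' B' : finType) (Lam : bop A B -> bop A' B'),
    LOCC Lam -> P _ _ _ _ Lam.
Proof.
move=> Plocal PAlice PBob A B A' B' Lam.
elim=> {A B A' B' Lam}
  [A B A' B' I J K L K1 L1|A B A1 A' B' I J K Psi K1 PsiL PsiP
  |A B B1 A' B' I J L Psi L1 PsiL PsiP].
- by rewrite (sum_sandwE (fun i j => kron (K i) (L j))); exact: Plocal.
- by rewrite (sum_channelE (fun i j => sandw (kron (K i j) (idm B)))); exact: PAlice.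
- by rewrite (sum_channelE (fun i j => sandw (kron (idm A) (L i j)))); exact: PBob.
Qed.

Definition krons A B A' B' (s : seq (mat A' A * mat B' B)) :
  seq (mat (A' * B')%type (A * B)%type) := [seq kron p.1 p.2 | p <- s].

Lemma kraus_complete_kron A B A' B' (I J : finType) (K : I -> mat A' A)
    (L : J -> mat B' B) :
  tp_kraus K -> tp_kraus L ->
  \sum_i \sum_j mulm (adjm (kron (K i) (L j))) (kron (K i) (L j)) = idm (A * B)%type.
Proof.
move=> /tp_krausP K1 /tp_krausP L1; rewrite -kron1 -K1 -L1 kron_suml.
apply: eq_bigr => i _; rewrite kron_sumr; apply: eq_bigr => j _.
by rewrite adjm_kron mulm_kron.
Qed.

Lemma tp_kraus_idm A : tp_kraus (fun _ : unit => idm A : mat A A).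
Proof. by apply/tp_krausP; rewrite sum_unit mulm1 adjm1. Qed.

Lemma kraus_complete_kronl A B A' (I : finType) (K : I -> mat A' A) : tp_kraus K ->
  \sum_i mulm (adjm (kron (K i) (idm B))) (kron (K i) (idm B)) = idm (A * B)%type.
Proof.
move=> /kraus_complete_kron/(_ (@tp_kraus_idm B)) <-; apply: eq_bigr => i _.
by rewrite sum_unit.
Qed.

Lemma kraus_complete_kronr A B B' (J : finType) (L : J -> mat B' B) : tp_kraus L ->
  \sum_j mulm (adjm (kron (idm A) (L j))) (kron (idm A) (L j)) = idm (A * B)%type.
Proof.
by move=> /(kraus_complete_kron (@tp_kraus_idm A)); rewrite sum_unit.
Qed.

(* Both kinds of LOCC round are instances: one of [K], [L] is the identity. *)
Lemma kraus_krons_round A B A1 B1 A' B' (I J : finType)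
    (K : I -> J -> mat A1 A) (L : I -> J -> mat B1 B)
    (s : I -> seq (mat A' A1 * mat B' B1)) :
  let M i j := kron (K i j) (L i j) in
  \sum_i \sum_j mulm (adjm (M i j)) (M i j) = idm (A * B)%type ->
  (forall i, kraus_complete (krons (s i))) ->
  exists2 t : seq (mat A' A * mat B' B), kraus_complete (krons t)
    & forall X, \sum_i kraus (krons (s i)) (\sum_j sandw (M i j) X) = kraus (krons t) X.
Proof.
move=> M M1 s1.
have sumE (V : nmodType) (F : mat _ _ -> V) i :
    \sum_j \sum_(N <- krons (s i)) F (mulm N (M i j))

      = \sum_(p <- [seq (mulm p.1 (K i j), mulm p.2 (L i j)) | j <- index_enum J, p <- s i])
        F (kron p.1 p.2).
  rewrite big_allpairs_dep; apply: eq_bigr => j _; rewrite big_map.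
  by apply: eq_bigr => p _; rewrite mulm_kron.
exists (flatten [seq [seq (mulm p.1 (K i j), mulm p.2 (L i j))
    | j <- index_enum J, p <- s i] | i <- index_enum I]) => [|X].
  rewrite /kraus_complete big_map big_flatten big_map -M1; apply: eq_bigr => i _.
  rewrite -(sumE _ (fun N => mulm (adjm N) N)); apply: eq_bigr => j _.
  rewrite -[X in _ = mulm _ X]mul1m.
  rewrite -[X in _ = mulm _ (mulm X _)](s1 i) mulm_suml linear_sum.
  by apply: eq_bigr => N _; rewrite /= adjm_mulm !mulmA.
rewrite /kraus big_map big_flatten big_map; apply: eq_bigr => i _.
rewrite -(sumE _ (fun N => sandw N X)) -/(kraus _ _) linear_sum.
by apply: eq_bigr => j _; apply: eq_bigr => N _; rewrite sandw_mulm.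
Qed.

Lemma LOCC_separable_kraus A B A' B' (Lam : bop A B -> bop A' B') : LOCC Lam ->
  exists s : seq (mat A' A * mat B' B),
    kraus_complete (krons s) /\ Lam = kraus (krons s).
Proof.
elim/LOCC_sum_ind => {A B A' B' Lam}
  [A B A' B' I J K L K1 L1|A B A1 A' B' I J K Psi K1 _|A B B1 A' B' I J L Psi L1 _].
- exists [seq (K i, L j) | i <- index_enum I, j <- index_enum J].
  split; last by apply/funext => X; rewrite /kraus big_map big_allpairs_dep.
  by rewrite /kraus_complete big_map big_allpairs_dep; exact: kraus_complete_kron.
- move=> /choice[s /all_and2[s1 PsiE]].
  have [|t t1 tE] := @kraus_krons_round _ _ _ _ _ _ _ _ K (fun _ _ => idm B) s _ s1.
    by rewrite -[RHS](kraus_complete_kronl _ K1) [RHS]sum_pair.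
  by exists t; split=> //; apply/funext => X; rewrite -tE;
    under eq_bigr do rewrite PsiE.
- move=> /choice[s /all_and2[s1 PsiE]].
  have [|t t1 tE] := @kraus_krons_round _ _ _ _ _ _ _ _ (fun _ _ => idm A) L s _ s1.
    by rewrite -[RHS](kraus_complete_kronr _ L1) [RHS]sum_pair.
  by exists t; split=> //; apply/funext => X; rewrite -tE;
    under eq_bigr do rewrite PsiE.
Qed.

Lemma LOCC_sum A B A' B' (Lam : bop A B -> bop A' B') (I : Type) (r : seq I)
    (X : I -> bop A B) :
  LOCC Lam -> Lam (\sum_(k <- r) X k) = \sum_(k <- r) Lam (X k).
Proof.
by move=> /LOCC_separable_kraus[s [_ ->]]; exact: (linear_sum (kraus (krons s))).
Qed.

Lemma LOCCB A B A' B' (Lam : bop A B -> bop A' B') X Y :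
  LOCC Lam -> Lam (X - Y) = Lam X - Lam Y.
Proof.
by move=> /LOCC_separable_kraus[s [_ ->]]; exact: (linearB (kraus (krons s))).
Qed.

Lemma herm_LOCC A B A' B' (Lam : bop A B -> bop A' B') X :
  LOCC Lam -> herm X -> herm (Lam X).
Proof. by move=> /LOCC_separable_kraus[s [_ ->]]; exact: herm_kraus. Qed.

Lemma tnorm_LOCC A B A' B' (Lam : bop A B -> bop A' B') X :
  LOCC Lam -> herm X -> tnorm (Lam X) <= tnorm X.
Proof. by move=> /LOCC_separable_kraus[s [s1 ->]]; exact: tnorm_kraus. Qed.

Lemma LOCC_Alice_channel A B A1 A' B' (J : finType) (K : J -> mat A1 A)
    (Psi : bop A1 B -> bop A' B') : tp_kraus K -> LOCC Psi ->
  LOCC (fun X => Psi (\sum_j sandw (kron (K j) (idm B)) X)).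
Proof.
move=> /tp_krausP K1 PsiL.
rewrite (_ : (fun X => _) =
    fun X => \sum_(i : unit) Psi (\sum_j sandw (kron (K j) (idm B)) X)).
  by apply: (@LOCC_Alice_sum _ _ _ _ _ unit J (fun=> K) (fun=> Psi)) => //;
    apply/tp_krausP; rewrite sum_pair sum_unit.
by apply/funext => X; rewrite sum_unit.
Qed.

Lemma LOCC_Bob_channel A B B1 A' B' (J : finType) (L : J -> mat B1 B)
    (Psi : bop A B1 -> bop A' B') : tp_kraus L -> LOCC Psi ->
  LOCC (fun X => Psi (\sum_j sandw (kron (idm A) (L j)) X)).
Proof.
move=> /tp_krausP L1 PsiL.
rewrite (_ : (fun X => _) =
    fun X => \sum_(i : unit) Psi (\sum_j sandw (kron (idm A) (L j)) X)).
  by apply: (@LOCC_Bob_sum _ _ _ _ _ unit J (fun=> L) (fun=> Psi)) => //;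
    apply/tp_krausP; rewrite sum_pair sum_unit.
by apply/funext => X; rewrite sum_unit.
Qed.

Lemma LOCC_Bob_kraus A B B' (J : finType) (L : J -> mat B' B) : tp_kraus L ->
  LOCC (fun X => \sum_j sandw (kron (idm A) (L j)) X).
Proof.
move=> /(LOCC_local_sum (@tp_kraus_idm A)).
by under [fun X => _]eq_fun do rewrite sum_unit.
Qed.

Lemma LOCC_comp A B A' B' (Lam : bop A B -> bop A' B') : LOCC Lam ->
  forall A2 B2 (Lam' : bop A' B' -> bop A2 B2), LOCC Lam' -> LOCC (Lam' \o Lam).
Proof.
elim/LOCC_sum_ind => {A B A' B' Lam}
  [A B A' B' I J K L K1 L1|A B A1 A' B' I J K Psi K1 _ IH
  |A B B1 A' B' I J L Psi L1 _ IH]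
  A2 B2 Lam' Lam'L.
- rewrite (_ : _ \o _ = fun X => Lam' (\sum_j sandw (kron (idm A') (L j))
    (\sum_i sandw (kron (K i) (idm B)) X))).
    exact: (LOCC_Alice_channel K1 (LOCC_Bob_channel L1 Lam'L)).
  apply/funext => X /=; congr Lam'; rewrite exchange_big; apply: eq_bigr => j _.
  rewrite linear_sum; apply: eq_bigr => i _ /=.
  by rewrite -sandw_mulm mulm_kron mulm1 mul1m.
- rewrite (_ : _ \o _ = fun X => \sum_i (Lam' \o Psi i)
    (\sum_j sandw (kron (K i j) (idm B)) X)).
    exact: (LOCC_Alice_sum K1 (fun i => IH i _ _ _ Lam'L)).
  by apply/funext => X /=; rewrite LOCC_sum.
- rewrite (_ : _ \o _ = fun X => \sum_i (Lam' \o Psi i)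
    (\sum_j sandw (kron (idm A) (L i j)) X)).
    exact: (LOCC_Bob_sum L1 (fun i => IH i _ _ _ Lam'L)).
  by apply/funext => X /=; rewrite LOCC_sum.
Qed.

Definition swapm A B : mat (B * A)%type (A * B)%type :=
  fun p q => ((p.2, p.1) == q)%:R.

Lemma mulm_swapm A B T (X : mat (A * B)%type T) p q :
  mulm (@swapm A B) X p q = X (p.2, p.1) q.
Proof. exact: (sum_delta (p.2, p.1) (X^~ q)). Qed.

Lemma adjm_swapm A B : adjm (@swapm A B) = @swapm B A.
Proof.
apply: eq_mat => -[a b] [b' a']; rewrite /adjm /swapm conjc_nat !natr_pair_eq /=.
by rewrite mulrC [a' == a]eq_sym [b' == b]eq_sym.
Qed.

Lemma mulm_swapmr A B T (X : mat T (B * A)%type) p q :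
  mulm X (@swapm A B) p q = X p (q.2, q.1).
Proof.
rewrite -[X in LHS]adjmK -(adjm_swapm B A) -adjm_mulm /adjm mulm_swapm.
exact: conjcK.
Qed.

Lemma swapopE A B (X : bop A B) : swapop X = sandw (@swapm A B) X.
Proof. by apply: eq_mat => p q; rewrite /sandw adjm_swapm mulm_swapmr mulm_swapm. Qed.

Lemma swapm_kron A B A' B' (K : mat A' A) (L : mat B' B) :
  mulm (@swapm A' B') (kron K L) = mulm (kron L K) (@swapm A B).
Proof.
by apply: eq_mat => p q; rewrite mulm_swapm mulm_swapmr /kron mulrC.
Qed.

Lemma swapm_unitary A B : mulm (adjm (@swapm A B)) (@swapm A B) = idm (A * B)%type.
Proof. by rewrite adjm_swapm; apply: eq_mat => -[a b] q; rewrite mulm_swapm. Qed.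

Lemma swapopK A B (X : bop A B) : swapop (swapop X) = X.
Proof. by apply: eq_mat => -[a b] [c d]. Qed.

Lemma swapop_sandw A B A' B' (K : mat A' A) (L : mat B' B) X :
  swapop (sandw (kron K L) X) = sandw (kron L K) (swapop X).
Proof. by rewrite !swapopE -!sandw_mulm swapm_kron. Qed.

Lemma herm_swapop A B (X : bop A B) : herm X -> herm (swapop X).
Proof. by move=> hX; rewrite swapopE; exact: herm_sandw. Qed.

Lemma tnorm_swapop A B (X : bop A B) : herm X -> tnorm (swapop X) <= tnorm X.
Proof.
move=> hX; rewrite swapopE (_ : sandw _ X = kraus [:: @swapm A B] X).
  by rewrite tnorm_kraus// /kraus_complete big_seq1 swapm_unitary.
by rewrite /kraus big_seq1.
Qed.

Lemma LOCC_swap A B A' B' (Lam : bop A B -> bop A' B') :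
  LOCC Lam -> LOCC (fun X => swapop (Lam (swapop X))).
Proof.
have swap_sum (T U : finType) (I : finType) (X : I -> bop T U) :
    swapop (\sum_i X i) = \sum_i swapop (X i).
  by rewrite swapopE linear_sum; apply: eq_bigr => i _ /=; rewrite -swapopE.
elim/LOCC_sum_ind => {A B A' B' Lam}
  [A B A' B' I J K L K1 L1|A B A1 A' B' I J K Psi K1 _ IH
  |A B B1 A' B' I J L Psi L1 _ IH].
- rewrite (_ : (fun X => _) = fun X => \sum_j \sum_i sandw (kron (L j) (K i)) X).
    exact: LOCC_local_sum.
  apply/funext => X; rewrite swap_sum exchange_big; apply: eq_bigr => i _.
  by rewrite swap_sum; apply: eq_bigr => j _; rewrite swapop_sandw swapopK.
- rewrite (_ : (fun X => _) = fun X => \sum_i swapop (Psi i (swapop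
    (\sum_j sandw (kron (idm B) (K i j)) X)))).
    exact: (LOCC_Bob_sum (Psi := fun i Y => swapop (Psi i (swapop Y))) K1 IH).
  apply/funext => X; rewrite swap_sum; apply: eq_bigr => i _; congr (swapop (Psi i _)).
  by rewrite swap_sum; apply: eq_bigr => j _; rewrite swapop_sandw.
- rewrite (_ : (fun X => _) = fun X => \sum_i swapop (Psi i (swapop
    (\sum_j sandw (kron (L i j) (idm A)) X)))).
    exact: (LOCC_Alice_sum (Psi := fun i Y => swapop (Psi i (swapop Y))) L1 IH).
  apply/funext => X; rewrite swap_sum; apply: eq_bigr => i _; congr (swapop (Psi i _)).
  by rewrite swap_sum; apply: eq_bigr => j _; rewrite swapop_sandw.
Qed.

End LOCCStructure.

(** * Transition rates *)

Section TensorPowers.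
Variable R : realType.
Local Notation C := R[i].
Local Notation bop := (bop R).
Implicit Types A B T : finType.

Lemma prod_sum_pair (V : comPzSemiRingType) (n : nat) A B (F : 'I_n -> A * B -> V) :
  \prod_(k < n) \sum_p F k p
  = \sum_(x : {ffun 'I_n -> A} * {ffun 'I_n -> B}) \prod_(k < n) F k (x.1 k, x.2 k).
Proof.
under eq_bigr do rewrite sum_pair.
by rewrite bigA_distr_bigA sum_pair; apply: eq_bigr => f _; exact: bigA_distr_bigA.
Qed.

Lemma herm_tpow A B (rho : bop A B) n : herm rho -> herm (tpow rho n).
Proof.
move=> hrho; apply: eq_mat => x y; rewrite -[in RHS]hrho.
exact: (rmorph_prod conjc).
Qed.

Lemma trm_tpow A B (rho : bop A B) n : trm (tpow rho n) = trm rho ^+ n.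
Proof.
by rewrite /trm -(prod_sum_pair (fun=> fun p => rho p p)) prodr_const card_ord.
Qed.

Definition maxent_vec T : T * T -> C := fun p => (p.1 == p.2)%:R.

Definition maxent T : bop T T := #|T|%:R^-1 *: ketbra (@maxent_vec T) (@maxent_vec T).

Lemma psi_plusE : psi_plus = @maxent 'I_2.
Proof.
apply: eq_mat => x y; transitivity (2^-1 * ((x.1 == x.2)%:R * (y.1 == y.2)%:R) : C).
  by rewrite /psi_plus; do 2 case: eqP; rewrite !(mulr1, mulr0).
by rewrite /maxent card_ord; congr (_ * (_ * _)); exact/esym/conjc_nat.
Qed.

Lemma prodr_eq_ffun (V : comPzSemiRingType) n T (f g : {ffun 'I_n -> T}) :
  \prod_k (f k == g k)%:R = (f == g)%:R :> V.
Proof.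
have [->|fg] := eqVneq f g; first by rewrite big1// => k _; rewrite eqxx.
have [k fgk] : exists k, f k != g k.
  by apply/existsP; rewrite -negb_forall; apply: contra fg => /eqfunP/ffunP/eqP.
by rewrite (bigD1 k)//= (negPf fgk) mul0r.
Qed.

Lemma tpow_psi_plus n : tpow psi_plus n = @maxent {ffun 'I_n -> 'I_2}.
Proof.
apply: eq_mat => x y; rewrite psi_plusE /tpow big_split prodr_const !card_ord /=.
rewrite /maxent card_ffun !card_ord natrX -exprVn.
congr (_ * _); rewrite big_split /= prodr_eq_ffun; congr (_ * _).
by rewrite -(rmorph_prod conjc) prodr_eq_ffun.
Qed.

Lemma herm_maxent T : herm (@maxent T).
Proof. by rewrite /maxent /herm adjmZ adjm_ketbra conjc_inv conjc_nat. Qed.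

Lemma herm_psi_plus : herm (psi_plus : bop 'I_2 'I_2).
Proof. by rewrite psi_plusE; exact: herm_maxent. Qed.

Lemma swapop_psi_plus : swapop psi_plus = psi_plus :> bop 'I_2 'I_2.
Proof.
by apply: eq_mat => x y; rewrite /swapop /psi_plus /= ![_.2 == _]eq_sym.
Qed.

Lemma trm_psi_plus : trm (psi_plus : bop 'I_2 'I_2) = 1.
Proof. by rewrite /trm sum_pair !big_ord_recl !big_ord0 /psi_plus /=; field. Qed.

End TensorPowers.

Section Rates.
Variable R : realType.
Local Notation C := R[i].
Local Notation bop := (bop R).
Implicit Types A B T : finType.

Lemma LOCC_prepare A B A' B' (a : A' -> C) (b : B' -> C) :
  sqnorm a = 1 -> sqnorm b = 1 ->
  LOCC (fun X : bop A B => trm X *: ketbra (kronv a b) (kronv a b)).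
Proof.
have tp_prepare (T U : finType) (w : T -> C) : sqnorm w = 1 ->
    tp_kraus (fun t : U => ketbra w (basisv R t)).
  move=> w1; apply/tp_krausP; rewrite -sum_ketbra_basis; apply: eq_bigr => t _.
  by rewrite adjm_ketbra mulm_ketbra2 dot_self w1 scale1r.
move=> /(tp_prepare _ A) a1 /(tp_prepare _ B) b1.
rewrite (_ : (fun X => _) = fun X => \sum_i \sum_j
    sandw (kron (ketbra a (basisv R i)) (ketbra b (basisv R j))) X).
  exact: LOCC_local_sum.
apply/funext => X; rewrite /trm scaler_suml sum_pair.
apply: eq_bigr => i _; apply: eq_bigr => j _.
rewrite -ketbra_kronv -(basisv_pair _ (i, j)).
by rewrite /sandw adjm_ketbra -mulmA mulm_ketbra mulm_ketbra2 mulmv_basis dot_basisl.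
Qed.

Lemma achievable0 A B A' B' (rho : bop A B) (sigma : bop A' B') :
  trm rho = 1 -> achievable rho sigma 0.
Proof.
have sqnorm_one T : sqnorm ((fun=> 1) : {ffun 'I_0 -> T} -> C) = 1.
  transitivity (\sum_(x : {ffun 'I_0 -> T}) (1 : R)).
    by apply: eq_bigr => x _; rewrite Normc.normc1 expr1n.
  by rewrite sumr_const card_ffun card_ord.
move=> rho1; split=> //; exists (fun=> 0%N).
exists (fun n X =>
  trm X *: ketbra (kronv (fun=> 1) (fun=> 1)) (kronv (fun=> 1) (fun=> 1))).
split=> [n|]; first by apply: LOCC_prepare; exact: sqnorm_one.
split; first by under eq_fun do rewrite mul0r; exact: cvg_cst.
rewrite (_ : (fun _ => _) = fun=> 0); first exact: cvg_cst.
apply/funext => n; rewrite trm_tpow rho1 expr1n scale1r.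
rewrite (_ : ketbra _ _ = tpow sigma 0); first exact: tnorm_subm_refl.
apply: eq_mat => x y; rewrite /tpow big_ord0.
by rewrite -[LHS]/(1 * 1 * conjc (1 * 1)) mulr1 conjc1 mulr1.
Qed.

Lemma cvg_ratio_pinfty (m : nat -> nat) (r : R) : 0 < r ->
  (fun n => (m n)%:R / n%:R : R) @ \oo --> r -> m @ \oo --> \oo.
Proof.
move=> r0 mr; apply/cvgnyPge => N.
have r2 : 0 < r / 2 by rewrite divr_gt0.
near=> n.
have n0 : (0 : R) < n%:R by rewrite ltr0n; near: n; exact: nbhs_infty_gt.
have mn : r / 2 < (m n)%:R / n%:R.
  by near: n; apply: (cvgr_gt _ mr); rewrite ltr_pdivrMr// ltr_pMr// ltr1n.
have Nn : N%:R / (r / 2) <= n%:R by near: n; exact: nbhs_infty_ger.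
rewrite -(ler_nat R) (le_trans (y := n%:R * (r / 2)))//.
  by rewrite -ler_pdivrMr.
by rewrite mulrC ltW// -ltr_pdivlMr.
Unshelve. all: by end_near. Qed.

Lemma tnorm_LOCC_triangle A B A' B' (Lam : bop A B -> bop A' B') X Y Z :
  LOCC Lam -> herm X -> herm Y -> herm Z ->
  tnorm (Lam X - Z) <= tnorm (X - Y) + tnorm (Lam Y - Z).
Proof.
move=> LamL hX hY hZ; rewrite -(subrKA (Lam Y)) -LOCCB//.
rewrite (le_trans (tnormD _ _))//; [|by apply: hermB => //; exact: herm_LOCC|].
  by apply: herm_LOCC => //; exact: hermB.
by rewrite lerD2r tnorm_LOCC//; exact: hermB.
Qed.

Lemma achievable_trans A B A1 B1 A2 B2 (rho : bop A B) (sigma : bop A1 B1)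
    (tau : bop A2 B2) r1 r2 :
  trm rho = 1 -> herm rho -> herm sigma -> herm tau ->
  achievable rho sigma r1 -> achievable sigma tau r2 -> achievable rho tau (r1 * r2).
Proof.
move=> rho1 hrho hsigma htau [r1_ge0 [m1 [L1 [locc1 [m1r err1]]]]].
move=> [r2_ge0 [m2 [L2 [locc2 [m2r err2]]]]].
have [->|r1_neq0] := eqVneq r1 0; first by rewrite mul0r; exact: achievable0.
have m1oo : m1 @ \oo --> \oo by apply: cvg_ratio_pinfty m1r; rewrite lt0r r1_neq0.
split; first exact: mulr_ge0.
exists (m2 \o m1), (fun n => L2 (m1 n) \o L1 n); split=> [n|].
  exact: LOCC_comp (locc1 n) _ _ _ (locc2 (m1 n)).
split.
  apply: cvg_trans (cvgM m1r (cvg_comp _ _ m1oo m2r)); apply: near_eq_cvg.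
  have /cvgnyPge/(_ 1%N) := m1oo; apply: filterS => n m1_gt0 /=.
  by rewrite mulrC mulrA divfK// pnatr_eq0 -lt0n.
have err0 : (fun n => tnorm (L1 n (tpow rho n) - tpow sigma (m1 n)) +
    tnorm (L2 (m1 n) (tpow sigma (m1 n)) - tpow tau (m2 (m1 n)))) @ \oo --> (0 : R).
  by rewrite -[0](addr0 0); exact: cvgD err1 (cvg_comp _ _ m1oo err2).
apply: (squeeze_cvgr _ (cvg_cst 0) err0); apply: nearW => n /=.
have hL1 : herm (L1 n (tpow rho n)) by apply: herm_LOCC => //; exact: herm_tpow.
rewrite tnorm_LOCC_triangle ?tnorm_ge0//; try exact: herm_tpow.
by apply: hermB; [exact: herm_LOCC|exact: herm_tpow].
Qed.

Lemma achievable_swap A B A' B' (rho : bop A B) (sigma : bop A' B') r :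
  herm rho -> herm sigma ->
  achievable rho sigma r -> achievable (swapop rho) (swapop sigma) r.
Proof.
move=> hrho hsigma [r0 [m [L [LL [mr err]]]]]; split=> //.
exists m, (fun n X => swapop (L n (swapop X))); split=> [n|];
  first exact: LOCC_swap (LL n).
split=> //; apply: (squeeze_cvgr _ (cvg_cst 0) err); apply: nearW => n /=.
have herr : herm (subm (L n (tpow rho n)) (tpow sigma (m n))).
  by apply: hermB; [apply: herm_LOCC => //; exact: herm_tpow|exact: herm_tpow].
by rewrite (tnorm_ge0 (herm_swapop herr)) (tnorm_swapop herr).
Qed.

End Rates.

Section ExtendedRates.
Local Open Scope ereal_scope.
Variable R : realType.
Implicit Types A B : finType.

Lemma ereal_sup_mul_le (S : set (\bar R)) (x c : \bar R) :
  S 0 -> 0 <= x -> (forall a, S a -> a * x <= c) -> ereal_sup S * x <= c.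
Proof.
move=> S0 x0 Sc; have c0 : 0 <= c by have := Sc _ S0; rewrite mul0e.
have sup0 : 0 <= ereal_sup S by exact: ereal_sup_ubound.
case: x x0 Sc => [x| |]// x0 Sc.
  move: x0; rewrite lee_fin le_eqVlt => /predU1P[<-|x0]; first by rewrite mule0.
  by rewrite -lee_pdivlMr//; apply: ge_ereal_sup => a Sa; rewrite lee_pdivlMr// Sc.
have [->|sup_neq0] := eqVneq (ereal_sup S) 0; first by rewrite mul0e.
have /ereal_sup_gt[a Sa a0] : 0 < ereal_sup S by rewrite lt0e sup_neq0.
by have := Sc a Sa; rewrite gt0_muley// leye_eq => /eqP ->; exact: leey.
Qed.

Lemma rate_ge0 A B A' B' (rho : bop R A B) (sigma : bop R A' B') :
  trm rho = 1%R -> 0 <= rate rho sigma.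
Proof.
by move=> rho1; apply: ereal_sup_ubound; exists 0%R => //; exact: achievable0.
Qed.

Lemma rate_trans A B A1 B1 A2 B2 (rho : bop R A B) (sigma : bop R A1 B1)
    (tau : bop R A2 B2) :
  trm rho = 1%R -> trm sigma = 1%R -> herm rho -> herm sigma -> herm tau ->
  rate rho sigma * rate sigma tau <= rate rho tau.
Proof.
move=> rho1 sigma1 hrho hsigma htau.
apply: ereal_sup_mul_le; [by exists 0%R => //; exact: achievable0|exact: rate_ge0|].
move=> _ [a ha <-]; rewrite muleC.
apply: ereal_sup_mul_le; [by exists 0%R => //; exact: achievable0|by case: ha|].
move=> _ [b hb <-]; rewrite -EFinM mulrC; apply: ereal_sup_ubound.
by exists (a * b)%R => //; exact: achievable_trans ha hb.
Qed.

Lemma rate_psi_plus_swap A B (rho : bop R A B) : herm rho ->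
  rate psi_plus (swapop rho) = rate psi_plus rho.
Proof.
move=> hrho; have hpsi := @herm_psi_plus R.
congr ereal_sup; apply/seteqP; split=> _ [r hr <-]; exists r => //.
  by rewrite -[rho]swapopK -swapop_psi_plus; apply: achievable_swap => //;
    exact: herm_swapop.
by rewrite -swapop_psi_plus; exact: achievable_swap.
Qed.

End ExtendedRates.

(** * Teleportation *)

Section Teleportation.
Variable R : realType.
Local Notation C := R[i].
Local Notation mat := (mat R).
Local Notation bop := (bop R).
Implicit Types A B I T U Q S : finType.

Definition conjm T U (X : mat T U) : mat T U := fun i j => conjc (X i j).

Lemma tp_kraus_conjm I T U (K : I -> mat T U) :
  tp_kraus K -> tp_kraus (fun i => conjm (K i)).
Proof.
move=> K1 x y; rewrite -[RHS](conjc_nat R (x == y)) -/(idm U x y) -K1 rmorph_sum.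
by apply: eq_bigr => i _; rewrite /= rmorph_sum; apply: eq_bigr => z _; rewrite rmorphM.
Qed.

Lemma tp_kraus_mulm I T U (K : I -> mat T U) (V : mat U U) :
  tp_kraus K -> unitary V -> tp_kraus (fun i => mulm (K i) V).
Proof.
move=> /tp_krausP K1 V1; apply/tp_krausP;
  rewrite -[RHS]V1 -[in X in _ = mulm _ X](mul1m V) -K1.
rewrite mulm_suml linear_sum; apply: eq_bigr => i _ /=.
by rewrite adjm_mulm !mulmA.
Qed.

Definition embedm T Q (f : T -> Q) : mat T Q := fun t y => (y == f t)%:R.

Lemma mulm_embedm T Q U (f : T -> Q) (X : mat Q U) t u :
  mulm (embedm f) X t u = X (f t) u.
Proof.
rewrite -[RHS](sum_delta (f t) (X^~ u)); apply: eq_bigr => y _.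
by rewrite /embedm eq_sym.
Qed.

Lemma mulm_adj_embedm T Q (f : T -> Q) :
  mulm (adjm (embedm f)) (embedm f) = \sum_t ketbra (basisv R (f t)) (basisv R (f t)).
Proof.
apply: eq_mat => y y'; rewrite sum_matE; apply: eq_bigr => t _.
by rewrite /adjm /ketbra /embedm /basisv !conjc_nat.
Qed.

Definition unembed_kraus T Q (f : T -> Q) (t0 : T) (o : unit + Q) : mat T Q :=
  if o is inr y then (y \notin codom f)%:R *: ketbra (basisv R t0) (basisv R y)
  else embedm f.

Lemma tp_unembed_kraus T Q (f : T -> Q) (t0 : T) : injective f ->
  tp_kraus (unembed_kraus f t0).
Proof.
move=> f_inj; apply/tp_krausP.
rewrite big_sumType sum_unit /= mulm_adj_embedm -sum_ketbra_basis.
rewrite [RHS](bigID (mem (codom f))) /=; congr (_ + _).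
  rewrite -big_uniq /=; last by rewrite map_inj_uniq ?enum_uniq.
  by rewrite [RHS]big_image.
rewrite [RHS]big_mkcond; apply: eq_bigr => y _.
rewrite linearZ /= adjmZ adjm_ketbra scale_mulml mulm_ketbra2 dot_basisl /basisv eqxx.
by rewrite scale1r conjc_nat; case: ifP => _; rewrite ?scale1r ?scale0r.
Qed.

Lemma embedm_coisometry T Q (f : T -> Q) : injective f ->
  mulm (embedm f) (adjm (embedm f)) = idm T.
Proof.
move=> f_inj; apply: eq_mat => t t'.
by rewrite mulm_embedm /adjm /embedm conjc_nat (inj_eq f_inj).
Qed.

Lemma mulm_embedm_unembed T Q (f : T -> Q) (t0 : T) y :
  mulm (embedm f) (adjm (unembed_kraus f t0 (inr y))) = 0.
Proof.
apply: eq_mat => t t'; rewrite mulm_embedm adjmZ adjm_ketbra conjc_nat.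
have [_|fy] := boolP (y \in codom f); first by rewrite scale0r.
rewrite scale1r /ketbra /basisv (_ : f t == y = false) ?mul0r//.
by apply: contraNF fy => /eqP <-; exact: codom_f.
Qed.

Definition vecm A B (X : mat A B) : A * B -> C := fun p => X p.1 p.2.

Definition unvecm A B (w : A * B -> C) : mat A B := fun a b => w (a, b).

Lemma vecmK A B (w : A * B -> C) : vecm (unvecm w) = w.
Proof. by apply/funext => -[]. Qed.

Lemma mulmv_kron_maxent A B Q (K : mat A Q) (V : mat B Q) :
  mulmv (kron K (conjm V)) (@maxent_vec R Q) = vecm (mulm K (adjm V)).
Proof.
apply/funext => x; rewrite /mulmv sum_pair; apply: eq_bigr => i _.
rewrite -[RHS](sum_delta i (fun j => K x.1 i * conjc (V x.2 j))).
by apply: eq_bigr => j _; rewrite mulrC.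
Qed.

Lemma trm_mulm_unvecm A B (w : A * B -> C) :
  trm (mulm (adjm (unvecm w)) (unvecm w)) = (sqnorm w)%:C.
Proof.
rewrite trm_mulmC -dot_self /dot sum_pair; apply: eq_bigr => a _.
by apply: eq_bigr => b _; rewrite mulrC.
Qed.

Definition unitary_basis I Q (U : I -> mat Q Q) : Prop :=
  [/\ forall q, unitary (U q), forall q, unitary (adjm (U q))
    & forall y y' z z', \sum_q conjc (U q y z) * U q y' z'
        = #|Q|%:R * (y == y')%:R * (z == z')%:R].

Lemma unitary_basis_twirl I Q (U : I -> mat Q Q) (N : mat Q Q) : unitary_basis U ->
  \sum_q sandw (adjm (U q)) N = (#|Q|%:R * trm N) *: idm Q.
Proof.
move=> [_ _ Ubasis]; apply: eq_mat => z z'; rewrite sum_matE.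
transitivity (\sum_y \sum_y' N y y' * \sum_q conjc (U q y z) * U q y' z').
  under [RHS]eq_bigr do under eq_bigr do rewrite mulr_sumr.
  under [RHS]eq_bigr do rewrite exchange_big.
  rewrite [RHS]exchange_big; apply: eq_bigr => q _ /=.
  rewrite /sandw adjmK -mulmA; apply: eq_bigr => y _; rewrite mulr_sumr.
  by apply: eq_bigr => y' _; rewrite mulrCA.
transitivity (\sum_y #|Q|%:R * N y y * idm Q z z').
  apply: eq_bigr => y _; rewrite -(sum_delta y (fun y' => #|Q|%:R * N y y' * _)).
  by apply: eq_bigr => y' _; rewrite Ubasis /idm; ring.
by rewrite -mulr_suml -mulr_sumr.
Qed.

Lemma card_unitary_basis I Q (U : I -> mat Q Q) (y : Q) : unitary_basis U ->
  #|I|%:R = #|Q|%:R ^+ 2 :> C.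
Proof.
move=> Ub; have := unitary_basis_twirl (idm Q) Ub; have [U1 _ _] := Ub.
have diagE (c : C) : (c *: idm Q) y y = c.
  by transitivity (c * (y == y)%:R); rewrite // eqxx mulr1.
have -> : trm (idm Q) = #|Q|%:R :> C.
  by rewrite /trm -[RHS]sumr_const; apply: eq_bigr => z _; rewrite /idm eqxx.
under eq_bigr do rewrite /sandw mulm1 adjmK U1.
by rewrite sumr_const -expr2 -scaler_nat => /(congr1 (fun X : mat Q Q => X y y));
  rewrite !diagE.
Qed.

Section Protocol.
Variables (I Q A B S : finType) (U : I -> mat Q Q) (f : B -> Q) (b0 : B).
Variables (omega : bop A B) (phi : S -> A * B -> C).
Hypotheses (Ub : unitary_basis U) (f_inj : injective f) (omega1 : trm omega = 1).
Hypothesis omegaE : omega = \sum_s ketbra (phi s) (phi s).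

Let cardQ_neq0 : #|Q|%:R != 0 :> C.
Proof. by rewrite pnatr_eq0 -lt0n; apply/card_gt0P; exists (f b0). Qed.

Let sqrt_card : C := (Num.sqrt #|Q|%:R^-1)%:C.

Let normc_sqrt_card : (normc sqrt_card ^+ 2)%:C = #|Q|%:R^-1.
Proof.
rewrite normc_real real_normK ?num_real// sqr_sqrtr ?invr_ge0//.
by rewrite fmorphV rmorph_nat.
Qed.

(* Alice applies a component [w] of the target, seen as an operator on [B], to her half
   of the resource rotated by [U q]; Bob undoes the rotation. *)
Definition teleport_Alice (w : A * B -> C) q : mat A Q :=
  sqrt_card *: mulm (unvecm w) (mulm (embedm f) (U q)).

Definition teleport_Bob q (o : unit + Q) : mat B Q :=
  mulm (unembed_kraus f b0 o) (U q).

Lemma tp_teleport_Alice : tp_kraus (fun qs : I * S => teleport_Alice (phi qs.2) qs.1).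
Proof.
apply/tp_krausP; rewrite sum_pair exchange_big /=.
have sqrE w q : mulm (adjm (teleport_Alice w q)) (teleport_Alice w q) =
    #|Q|%:R^-1 *: sandw (adjm (U q))
      (sandw (adjm (embedm f)) (mulm (adjm (unvecm w)) (unvecm w))).
  rewrite adjmZ scale_mulml linearZ scalerA mulJc normc_sqrt_card /=; congr (_ *: _).
  by rewrite !adjm_mulm /sandw !adjmK !mulmA.
under eq_bigr do (under eq_bigr do rewrite sqrE);
  under eq_bigr do rewrite -scaler_sumr (unitary_basis_twirl _ Ub) scalerA mulKf//.
rewrite -scaler_suml -[RHS]scale1r -omega1 omegaE linear_sum; congr (_ *: _).
apply: eq_bigr => s _; rewrite /= trm_ketbra dot_self -trm_mulm_unvecm.
by rewrite /sandw adjmK -mulmA trm_mulmC -mulmA embedm_coisometry// mulm1.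
Qed.

Lemma sandw_teleport w q o :
  sandw (kron (teleport_Alice w q) (conjm (teleport_Bob q o))) (@maxent R Q)
  = if o is inl _ then #|Q|%:R^-1 ^+ 2 *: ketbra w w else 0.
Proof.
have UU : mulm (U q) (adjm (U q)) = idm Q.
  by have [_ /(_ q) + _] := Ub; rewrite /unitary adjmK.
have corrected : mulm (teleport_Alice w q) (adjm (teleport_Bob q o)) =
    sqrt_card *: mulm (unvecm w) (mulm (embedm f) (adjm (unembed_kraus f b0 o))).
  by rewrite scale_mulml adjm_mulm -!mulmA (mulmA (U q)) UU mul1m.
rewrite linearZ /= sandw_ketbra mulmv_kron_maxent corrected.
case: o {corrected} => [[]|y].
  rewrite embedm_coisometry// mulm1 -[vecm _]/(sqrt_card *: vecm (unvecm w)) vecmK.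
  by rewrite ketbraZ normc_sqrt_card scalerA.
rewrite mulm_embedm_unembed linear0 scaler0 (_ : ketbra _ _ = 0) ?scaler0//.
by apply: eq_mat => i j; exact: mul0r.
Qed.

Lemma teleportation :
  exists2 Lam : bop Q Q -> bop A B, LOCC Lam & Lam (@maxent R Q) = omega.
Proof.
exists (fun X => \sum_q \sum_o sandw (kron (idm A) (conjm (teleport_Bob q o)))
    (\sum_s sandw (kron (teleport_Alice (phi s) q) (idm Q)) X)).
  apply: (LOCC_Alice_sum (K := fun q s => teleport_Alice (phi s) q)
    (Psi := fun q X => \sum_o sandw (kron (idm A) (conjm (teleport_Bob q o))) X)
    tp_teleport_Alice) => q.
  have [U1 _ _] := Ub; apply: LOCC_Bob_kraus; apply/tp_kraus_conjm/tp_kraus_mulm => //.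
  exact: tp_unembed_kraus.
transitivity (\sum_(q : I) #|Q|%:R^-1 ^+ 2 *: omega); last first.
  rewrite sumr_const -scaler_nat (card_unitary_basis (f b0) Ub) scalerA -exprMn.
  by rewrite mulfV// expr1n scale1r.
apply: eq_bigr => q _; under eq_bigr do rewrite linear_sum.
under eq_bigr do under eq_bigr do
  rewrite /= -sandw_mulm mulm_kron mulm1 mul1m sandw_teleport.
rewrite big_sumType sum_unit /= -scaler_sumr -omegaE [X in _ + X]big1 ?addr0// => y _.
exact: big1.
Qed.

End Protocol.

Section Pauli.
Variable n : nat.
Local Notation qubits := {ffun 'I_n -> 'I_2}.

Definition pauli_sign (t z : qubits) : C := (-1) ^+ (\sum_k t k * z k)%N.

Definition pauli (q : qubits * qubits) : mat qubits qubits :=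
  fun y z => (y == z + q.1)%:R * pauli_sign q.2 z.

Lemma conjc_pauli q y z : conjc (pauli q y z) = pauli q y z.
Proof. by rewrite rmorphM /= conjc_nat [conjc (pauli_sign _ _)]rmorph_sign. Qed.

Lemma pauli_sign_sqr t z : pauli_sign t z * pauli_sign t z = 1.
Proof. by rewrite -expr2 sqrr_sign. Qed.

Lemma sum_pauli_sign z z' :
  \sum_t pauli_sign t z * pauli_sign t z' = 2 ^+ n * (z == z')%:R.
Proof.
under eq_bigr do rewrite /pauli_sign -!prodrXr -big_split /=.
rewrite -(bigA_distr_bigA (fun k (a : 'I_2) => (-1) ^+ (a * z k) * (-1) ^+ (a * z' k))).
have sum_bit (b b' : 'I_2) :
    \sum_(a : 'I_2) (-1) ^+ (a * b) * (-1) ^+ (a * b') = 2 * (b == b')%:R :> C.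
  by case: b b' => [[|[]]] // ? [[|[]]] // ?; rewrite !big_ord_recl big_ord0 /=; ring.
under eq_bigr do rewrite sum_bit.
by rewrite big_split prodr_const card_ord prodr_eq_ffun.
Qed.

Lemma pauli_unitary q : unitary (pauli q).
Proof.
apply: eq_mat => z z'; rewrite /mulm /adjm; under eq_bigr do rewrite conjc_pauli.
transitivity (\sum_y (z + q.1 == y)%:R *
    ((y == z' + q.1)%:R * (pauli_sign q.2 z * pauli_sign q.2 z'))).
  by apply: eq_bigr => y _; rewrite /pauli [z + _ == _]eq_sym; ring.
rewrite sum_delta (inj_eq (addIr _)) /idm; case: eqP => [->|_]; last by rewrite mul0r.
by rewrite pauli_sign_sqr mulr1.
Qed.

Lemma pauli_adj_unitary q : unitary (adjm (pauli q)).
Proof.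
rewrite /unitary adjmK; apply: eq_mat => y y'; rewrite /mulm /adjm.
under eq_bigr do rewrite conjc_pauli.
transitivity (\sum_z (y - q.1 == z)%:R * (y' - q.1 == z)%:R : C).
  apply: eq_bigr => z _; rewrite /pauli !subr_eq -[RHS]mulr1 -(pauli_sign_sqr q.2 z).
  ring.
by rewrite sum_delta (inj_eq (addIr _)) eq_sym.
Qed.

Lemma unitary_basis_pauli : unitary_basis pauli.
Proof.
split=> [||y y' z z']; [exact: pauli_unitary|exact: pauli_adj_unitary|].
rewrite sum_pair card_ffun !card_ord natrX.
transitivity (\sum_u (y - z == u)%:R *
    ((y' - z' == u)%:R * \sum_t pauli_sign t z * pauli_sign t z')).
  apply: eq_bigr => u _; rewrite !mulr_sumr; apply: eq_bigr => t _.
  by rewrite conjc_pauli /pauli /= !subr_eq ![u + _]addrC; ring.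
rewrite sum_delta sum_pauli_sign; have [->|_] := eqVneq z z'; last by rewrite !mulr0.
by rewrite (inj_eq (addIr _)) eq_sym; ring.
Qed.

End Pauli.

End Teleportation.

Lemma injection_of_card (T U : finType) : (#|T| <= #|U|)%N ->
  exists f : T -> U, injective f.
Proof.
move=> h; exists (fun x => enum_val (widen_ord h (enum_rank x))) => x y.
by move=> /enum_val_inj/(congr1 val)/= /val_inj/enum_rank_inj.
Qed.

Lemma cvg_divn_ratio (R : realType) (l : nat) : (0 < l)%N ->
  (fun n => (n %/ l)%:R / n%:R : R) @ \oo --> (l%:R^-1 : R).
Proof.
move=> l0; have l0' : (0 : R) < l%:R by rewrite ltr0n.
have inv0 : (fun n => (n%:R : R)^-1) @ \oo --> (0 : R).
  apply/gtr0_cvgV0; last exact: cvgr_idn.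
  by near=> n; rewrite ltr0n; near: n; exact: nbhs_infty_gt.
have lower : (fun n => l%:R^-1 - (n%:R : R)^-1) @ \oo --> (l%:R^-1 : R).
  by rewrite -[X in _ --> X]subr0; apply: cvgB => //; exact: cvg_cst.
apply: (squeeze_cvgr _ lower (cvg_cst _)).
near=> n; have n0 : (0 : R) < n%:R by rewrite ltr0n; near: n; exact: nbhs_infty_gt.
have divE : n%:R = (n %/ l)%:R * l%:R + (n %% l)%:R :> R.
  by rewrite -natrM -natrD -divn_eq.
have mod_lt : (n %% l)%:R < l%:R :> R by rewrite ltr_nat ltn_mod.
apply/andP; split.
  rewrite lerBlDr -[X in _ + X]mul1r -mulrDl ler_pdivlMr// mulrC ler_pdivrMr//.
  by rewrite mulrDl mul1r {1}divE lerD2l ltW.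
by rewrite ler_pdivrMr// mulrC ler_pdivlMr// {1}divE lerDl.
Unshelve. all: by end_near. Qed.

Lemma psi_plus_to_tpow (R : realType) (A B : finType) (rho : bop R A B) n m :
  is_state rho -> (#|B| ^ m <= 2 ^ n)%N ->
  exists2 Lam : bop R {ffun 'I_n -> 'I_2} {ffun 'I_n -> 'I_2} ->
                bop R {ffun 'I_m -> A} {ffun 'I_m -> B},
    LOCC Lam & Lam (tpow psi_plus n) = tpow rho m.
Proof.
move=> [rho0 rho1] Bn; have [phi rhoE] := psd_sum_ketbra rho0.
have [[a0 b0]] := trm1_inhabited rho1.
have [J J_inj] : exists J : {ffun 'I_m -> B} -> {ffun 'I_n -> 'I_2}, injective J.
  by apply: injection_of_card; rewrite !card_ffun !card_ord.
rewrite tpow_psi_plus.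
apply: (teleportation (omega := tpow rho m)
  (phi := fun (s : {ffun 'I_m -> A * B}) x => \prod_k phi (s k) (x.1 k, x.2 k))
  [ffun=> b0] (@unitary_basis_pauli R n) J_inj).
  by rewrite trm_tpow rho1 expr1n.
apply: eq_mat => x y; rewrite sum_matE /tpow rhoE; under eq_bigr do rewrite sum_matE.
rewrite bigA_distr_bigA; apply: eq_bigr => s _.
by rewrite /ketbra big_split rmorph_prod.
Qed.

Lemma rate_psi_plus_gt0 (R : realType) (A B : finType) (rho : bop R A B) :
  is_state rho -> (0 < rate psi_plus rho)%E.
Proof.
move=> st; have [_ rho1] := st; have [[_ b0]] := trm1_inhabited rho1.
pose l := #|B|; have l0 : (0 < l)%N by apply/card_gt0P; exists b0.
apply: (@lt_le_trans _ _ (l%:R^-1%:E)); first by rewrite lte_fin invr_gt0 ltr0n.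
apply: ereal_sup_ubound; exists l%:R^-1 => //; split; first by rewrite invr_ge0.
have size_bound n : (#|B| ^ (n %/ l) <= 2 ^ n)%N.
  apply: (@leq_trans (2 ^ (l * (n %/ l)))).
    by rewrite expnM; case: (n %/ l)%N => // k; rewrite leq_exp2r// ltnW// ltn_expl.
  by rewrite leq_exp2l// mulnC leq_divM.
pose prepare n := cid2 (psi_plus_to_tpow st (size_bound n)).
exists (fun n => (n %/ l)%N), (fun n => s2val (prepare n)); split=> [n|].
  exact: s2valP.
split; first exact: cvg_divn_ratio.
rewrite (_ : (fun _ => _) = fun=> 0); first exact: cvg_cst.
apply/funext => n; have -> := s2valP' (prepare n).
exact: tnorm_subm_refl.
Qed.

(** * Separation from a compact convex hull *)

Lemma exists_linear_relation (F : fieldType) (I : finType) n (g : 'I_n -> I -> F) :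
  (#|I| < n)%N ->
  exists2 c : 'I_n -> F, exists k, c k != 0 & forall i, \sum_k c k * g k i = 0.
Proof.
move=> ltIn; pose M : 'M[F]_(n, #|I|) := \matrix_(k, j) g k (enum_val j).
have /rowV0Pn[c /sub_kermxP cM /rV0Pn[k ck]] : kermx M != 0.
  rewrite -mxrank_eq0 mxrank_ker -lt0n subn_gt0.
  exact: leq_ltn_trans (rank_leq_col _) ltIn.
exists (c 0) => [|i]; first by exists k.
have /rowP/(_ (enum_rank i)) := cM; rewrite !mxE => cMi; rewrite -[RHS]cMi.
by apply: eq_bigr => l _; rewrite mxE enum_rankK.
Qed.

Section RealContinuity.
Variables (R : realType) (T : topologicalType).
Implicit Types f g : T -> R.

Lemma continuous_fun_cst (c : R) : continuous (fun _ : T => c).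
Proof. by move=> x; exact: cvg_cst. Qed.

Lemma continuous_funD f g : continuous f -> continuous g ->
  continuous (fun x => f x + g x).
Proof. by move=> cf cg x; exact: (cvgD (cf x) (cg x)). Qed.

Lemma continuous_funM f g : continuous f -> continuous g ->
  continuous (fun x => f x * g x).
Proof. by move=> cf cg x; exact: (cvgM (cf x) (cg x)). Qed.

Lemma continuous_fun_sqr f : continuous f -> continuous (fun x => f x ^+ 2).
Proof. by move=> cf; under eq_fun do rewrite expr2; exact: continuous_funM. Qed.

Lemma continuous_fun_sum (J : finType) (F : J -> T -> R) :
  (forall j, continuous (F j)) -> continuous (fun x => \sum_j F j x).
Proof.
by move=> cF; apply: continuous_big => [|j _]; [exact: add_continuous|exact: cF].
Qed.

End RealContinuity.

Section ConvexHull.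
Variables (R : realType) (Z : finType) (T : topologicalType).
Variables (D : set T) (f : T -> Z -> R).
Hypotheses (compactD : compact D) (D0 : D !=set0).
Hypothesis cont_f : forall z, continuous (f^~ z).

Definition mixture n (th : 'I_n -> R * T) (z : Z) : R :=
  \sum_k (th k).1 * f (th k).2 z.

Definition convex_family n (th : 'I_n -> R * T) : Prop :=
  [/\ forall k, 0 <= (th k).1, \sum_k (th k).1 = 1 & forall k, D (th k).2].

Definition sqr_dist (p q : Z -> R) : R := \sum_z (p z - q z) ^+ 2.

(* Moving the weights along an affine dependence of the points, proportionally to
   the weights themselves, until the first of them vanishes. *)
Lemma caratheodory_zero_weight n (th : 'I_n -> R * T) : (#|Z|.+1 < n)%N ->
  convex_family th ->
  exists th' : 'I_n -> R * T,
    [/\ convex_family th', mixture th' =1 mixture th & exists k, (th' k).1 = 0].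
Proof.
move=> ltZn [th0 th1 thD].
pose g k (o : option Z) := (th k).1 * oapp (f (th k).2) 1 o.
have [|c [k0 ck0] cg] := @exists_linear_relation _ _ n g; first by rewrite card_option.
pose i := [arg max_(i > k0) `|c i|]%O.
have ci_max k : `|c k| <= `|c i| by rewrite /i; case: arg_maxP => // j _; exact.
have ci0 : c i != 0 by rewrite -normr_gt0 (lt_le_trans _ (ci_max k0))// normr_gt0.
have reweight F : \sum_k c k * ((th k).1 * F k) = 0 ->
    \sum_k (th k).1 * (1 - c k / c i) * F k = \sum_k (th k).1 * F k.
  move=> cF;
    transitivity (\sum_k (th k).1 * F k - (c i)^-1 * \sum_k c k * ((th k).1 * F k)).
    by rewrite mulr_sumr -sumrB; apply: eq_bigr => k _; ring.
  by rewrite cF mulr0 subr0.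
exists (fun k => ((th k).1 * (1 - c k / c i), (th k).2)); split.
- split=> [k||]//=.
    rewrite mulr_ge0// subr_ge0 (le_trans (ler_norm _))// normrM normfV.
    by rewrite ler_pdivrMr ?normr_gt0// mul1r.
  rewrite -[RHS]th1; under eq_bigr do rewrite -[_ * (1 - _)]mulr1.
  rewrite (reweight (fun=> 1)) ?(cg None)//.
  by apply: eq_bigr => k _; rewrite mulr1.
- by move=> z; rewrite /mixture /= (reweight (fun k => f (th k).2 z)) ?(cg (Some z)).
- by exists i; rewrite /= divff// subrr mulr0.
Qed.

Lemma convex_family_exists n : exists th : 'I_n.+1 -> R * T, convex_family th.
Proof.
have [t Dt] := D0; exists (fun k => ((k == ord0)%:R, t)); split=> //=.
by rewrite (bigD1 ord0)//= big1 ?addr0// => k /negPf ->.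
Qed.

Let space n : topologicalType := prod_topology (fun _ : 'I_n => (R * T)%type).

Lemma continuous_weight n (k : 'I_n) : continuous (fun th : space n => (th k).1).
Proof.
move=> th; apply: (@continuous_comp _ _ _ (fun th : space n => th k) fst).
  exact: (@proj_continuous _ (fun=> (R * T)%type)).
exact: cvg_fst.
Qed.

Lemma continuous_point n (k : 'I_n) z : continuous (fun th : space n => f (th k).2 z).
Proof.
move=> th; apply: (@continuous_comp _ _ _ (fun th : space n => (th k).2) (f^~ z)).
  apply: (@continuous_comp _ _ _ (fun th : space n => th k) snd).
    exact: (@proj_continuous _ (fun=> (R * T)%type)).
  exact: cvg_snd.
exact: cont_f.
Qed.

Lemma compact_convex_family n : compact ([set th | convex_family th] : set (space n)).
Proof.
pose box : set (space n) := [set th | forall k, (`[0, 1]%classic `*` D) (th k)].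
pose total_one : set (space n) := [set th | \sum_k (th k).1 = 1].
have -> : [set th | convex_family th] = box `&` total_one.
  apply/seteqP; split=> th /= [].
    move=> th0 th1 thD; split=> // k; split=> //=; rewrite in_itv /= th0 -th1.
    by rewrite (bigD1 k)//= lerDl sumr_ge0.
  move=> thbox th1; split=> // k; have [/=] := thbox k; last by [].
  by rewrite in_itv => /andP[].
apply: compact_closedI.
  apply: (@tychonoff _ (fun=> (R * T)%type) (fun=> `[0, 1]%classic `*` D)) => _.
  by apply: compact_setX => //; exact: segment_compact.
apply: (@preimage_closed (space n) R (fun th => \sum_k (th k).1) [set 1]).
  by move=> th _; apply: continuous_fun_sum => k; exact: continuous_weight.
exact: closed_eq.
Qed.

Lemma continuous_mixture n z : continuous (fun th : space n => mixture th z).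
Proof.
apply: continuous_fun_sum => k; apply: continuous_funM.
  exact: continuous_weight.
exact: continuous_point.
Qed.

Lemma continuous_sqr_dist n p :
  continuous (fun th : space n => sqr_dist p (mixture th)).
Proof.
apply: continuous_fun_sum => z; apply: continuous_fun_sqr => th.
exact: (cvgB (cvg_cst _) (@continuous_mixture n z th)).
Qed.

Lemma closest_mixture n p : exists2 th0 : 'I_n.+1 -> R * T, convex_family th0 &
  forall th : 'I_n.+1 -> R * T, convex_family th ->
    sqr_dist p (mixture th0) <= sqr_dist p (mixture th).
Proof.
have [|th] := @compact_EVT_min (space n.+1) R _ _ _ (@compact_convex_family _)
  (continuous_subspaceT (@continuous_sqr_dist n.+1 p)).
  exact: convex_family_exists.
by rewrite inE => th0 thmin; exists th => // th' th'0; apply: thmin; rewrite inE.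
Qed.

Lemma sqr_dist_segment p q r s :
  sqr_dist p (fun z => (1 - s) * q z + s * r z)
  = sqr_dist p q - 2 * s * \sum_z (p z - q z) * (r z - q z) + s ^+ 2 * sqr_dist r q.
Proof.
rewrite /sqr_dist !mulr_sumr -sumrB -big_split; apply: eq_bigr => z _ /=; ring.
Qed.

Lemma mixture_segment n (th : 'I_n -> R * T) k0 t s : convex_family th ->
  (th k0).1 = 0 -> D t ->
  0 <= s <= 1 ->
  exists th' : 'I_n -> R * T,
    convex_family th' /\ mixture th' =1 fun z => (1 - s) * mixture th z + s * f t z.
Proof.
move=> [th0 th1 thD] thk0 Dt /andP[s0 s1].
exists (fun k => if k == k0 then (s, t) else ((1 - s) * (th k).1, (th k).2)); split.
  split=> [k||k]; try by case: ifP => _ //=; rewrite mulr_ge0// subr_ge0.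
  have := th1; rewrite (bigD1 k0)//= thk0 add0r => th1'.
  rewrite (bigD1 k0)//= eqxx (eq_bigr (fun k => (1 - s) * (th k).1)) => [|k /negPf->//].
  by rewrite -mulr_sumr th1' mulr1 addrC subrK.
move=> z; rewrite /mixture [in RHS](bigD1 k0)//= thk0 mul0r add0r.
rewrite (bigD1 k0)//= eqxx addrC mulr_sumr; congr (_ + _).
by apply: eq_bigr => k /negPf -> /=; rewrite mulrA.
Qed.

Lemma le0_of_le_scale (x y : R) : 0 <= y ->
  (forall s, 0 <= s <= 1 -> s * x <= s ^+ 2 * y) -> x <= 0.
Proof.
move=> y0 xy; rewrite leNgt; apply/negP => x0.
have d0 : 0 < x + y + y by lra.
have s0 : 0 < x / (x + y + y) by rewrite divr_gt0.
have s1 : x / (x + y + y) <= 1 by rewrite ler_pdivrMr//; lra.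
have := xy _ (_ : 0 <= x / (x + y + y) <= 1); rewrite (ltW s0) s1 => /(_ isT).
by rewrite expr2 -mulrA ler_pM2l// mulrAC ler_pdivlMr// ler_pM2l//; lra.
Qed.

Lemma separation_from_hull p :
  (exists n (th : 'I_n -> R * T), convex_family th /\ mixture th =1 p) \/
  (exists h c, (forall t, D t -> \sum_z h z * f t z <= c) /\ c < \sum_z h z * p z).
Proof.
have [th0 th0mix th0min] := closest_mixture #|Z|.+1 p.
have [th [thmix thE [k0 thk0]]] := caratheodory_zero_weight (ltnSn _) th0mix.
pose q := mixture th.
have dist_min t s : D t -> 0 <= s <= 1 ->
    sqr_dist p q <= sqr_dist p (fun z => (1 - s) * q z + s * f t z).
  move=> Dt s01; have [th' [th'mix th'E]] := mixture_segment thmix thk0 Dt s01.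
  by rewrite -(funext th'E) /q (funext thE); exact: th0min.
have [pq0|pq0] := eqVneq (sqr_dist p q) 0; [left|right].
  exists #|Z|.+2, th; split=> // z; apply/esym/eqP; rewrite -subr_eq0 -sqrf_eq0.
  by rewrite (psumr_eq0P _ pq0)// => z' _; exact: sqr_ge0.
exists (fun z => p z - q z), (\sum_z (p z - q z) * q z); split=> [t Dt|].
  rewrite -subr_le0 -sumrB; under eq_bigr do rewrite -mulrBr.
  apply: (@le0_of_le_scale _ (sqr_dist (f t) q / 2)) => [|s s01].
    by rewrite divr_ge0// sumr_ge0// => z _; exact: sqr_ge0.
  have := dist_min t s Dt s01; rewrite sqr_dist_segment; lra.
rewrite -subr_gt0 -sumrB lt0r (_ : \sum_z _ = sqr_dist p q) ?pq0.
  by apply: sumr_ge0 => z _; exact: sqr_ge0.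
by apply: eq_bigr => z _; rewrite -mulrBr expr2.
Qed.

End ConvexHull.

(** * Separating an entangled state from product vectors *)

Section Outcomes.
Variable R : realType.
Local Notation C := R[i].
Local Notation mat := (mat R).
Implicit Types A B T X Y Z : finType.

Lemma qform_psdE Z T (V : Z -> T -> C) (M : mat T T) z : psd M ->
  qform (V z) M = (outcome V M z)%:C.
Proof. by move=> M0; rewrite RRe_real// ger0_real// psd_qform_ge0. Qed.

Lemma outcome_ge0 Z T (V : Z -> T -> C) (M : mat T T) z : psd M -> 0 <= outcome V M z.
Proof. by move=> M0; rewrite -ler0c -qform_psdE// psd_qform_ge0. Qed.

Lemma sum_outcome Z T (V : Z -> T -> C) (M : mat T T) : parseval_frame V -> trm M = 1 ->
  \sum_z outcome V M z = 1.
Proof. by move=> V1 M1; rewrite -Re_sum sum_qform_frame// M1. Qed.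

Lemma born_kron X A Y B (v : X -> A -> C) (u : Y -> B -> C) a b z :
  born (kron_frame v u) (kronv a b) z = born v a z.1 * born u b z.2.
Proof. by rewrite /born dot_kronv Normc.normcM exprMn. Qed.

Lemma bornZ Z T (V : Z -> T -> C) c w z : born V (c *: w) z = normc c ^+ 2 * born V w z.
Proof. by rewrite /born linearZ Normc.normcM exprMn. Qed.

End Outcomes.

Section UnitVectors.
Variables (R : realType) (T : finType).
Local Notation C := R[i].

Definition realvec : topologicalType := prod_topology (fun _ : T * bool => R).

Definition cvec (g : realvec) : T -> C := fun i => g (i, true) +i* g (i, false).

Lemma cvec_surj (w : T -> C) : exists g, cvec g = w.
Proof.
exists (fun p => if p.2 then Re (w p.1) else Im (w p.1)).
by apply/funext => i; rewrite /cvec /=; case: (w i).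
Qed.

Lemma sqnorm_cvec g : sqnorm (cvec g) = \sum_i (g (i, true) ^+ 2 + g (i, false) ^+ 2).
Proof. by apply: eq_bigr => i _; rewrite sqr_normcE. Qed.

Lemma normc_dot_cvec (u : T -> C) g : normc (dot u (cvec g)) ^+ 2 =
  (\sum_i (Re (u i) * g (i, true) + Im (u i) * g (i, false))) ^+ 2 +
  (\sum_i (Re (u i) * g (i, false) + - Im (u i) * g (i, true))) ^+ 2.
Proof.
rewrite sqr_normcE Re_sum Im_sum; congr (_ ^+ 2 + _ ^+ 2);
  by apply: eq_bigr => i _; rewrite /cvec; case: (u i) => a b /=; ring.
Qed.

Lemma continuous_coord p : continuous (fun g : realvec => g p).
Proof. exact: (@proj_continuous _ (fun=> R)). Qed.

Lemma continuous_linform (c d : T -> R) (p q : T -> T * bool) :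
  continuous (fun g : realvec => \sum_i (c i * g (p i) + d i * g (q i))).
Proof.
apply: continuous_fun_sum => i; apply: continuous_funD; apply: continuous_funM.
- exact: continuous_fun_cst.
- exact: continuous_coord.
- exact: continuous_fun_cst.
- exact: continuous_coord.
Qed.

Lemma continuous_born (Z : finType) (V : Z -> T -> C) z :
  continuous (fun g : realvec => born V (cvec g) z).
Proof.
under [X in continuous X]eq_fun do rewrite /born normc_dot_cvec.
by apply: continuous_funD; apply: continuous_fun_sqr; exact: continuous_linform.
Qed.

Lemma continuous_sqnorm_cvec : continuous (fun g : realvec => sqnorm (cvec g)).
Proof.
under [X in continuous X]eq_fun do rewrite sqnorm_cvec.
apply: continuous_fun_sum => i; apply: continuous_funD; apply: continuous_fun_sqr;
  exact: continuous_coord.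
Qed.

Lemma compact_unit_cvec : compact ([set g | sqnorm (cvec g) = 1] : set realvec).
Proof.
pose box : set realvec := [set g | forall p, `[-1, 1]%classic (g p)].
apply: (@subclosed_compact _ _ box).
- apply: (@preimage_closed realvec R (fun g => sqnorm (cvec g)) [set 1]);
    last exact: closed_eq.
  by move=> g _; exact: continuous_sqnorm_cvec.
- by apply: (@tychonoff _ (fun=> R) (fun=> `[-1, 1]%classic)) => _;
  exact: segment_compact.
move=> g /= g1 [i b];
  rewrite /= in_itv /= -ler_norml -(@expr_le1 _ 2)// real_normK ?num_real//.
rewrite -g1 sqnorm_cvec (bigD1 i)//=
  (le_trans (y := g (i, true) ^+ 2 + g (i, false) ^+ 2))//.
  by case: b; rewrite (lerDl, lerDr) sqr_ge0.
by rewrite lerDl sumr_ge0// => j _; rewrite addr_ge0 ?sqr_ge0.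
Qed.

End UnitVectors.

Section Witness.
Variable R : realType.
Local Notation C := R[i].
Local Notation bop := (bop R).
Implicit Types A B X Y : finType.

Lemma psd_ketbra (T : finType) (w : T -> C) : psd (ketbra w w).
Proof. by move=> v; rewrite -qformE qform_ketbra ler0c sqr_ge0. Qed.

Lemma is_state_ketbra (T : finType) (w : T -> C) : sqnorm w = 1 ->
  is_state (ketbra w w).
Proof. by move=> w1; split; [exact: psd_ketbra|rewrite trm_ketbra dot_self w1]. Qed.

Lemma unit_vector_scale (T : finType) (t0 : T) (w : T -> C) :
  exists2 w1 : T -> C, sqnorm w1 = 1 & w = (Num.sqrt (sqnorm w))%:C *: w1.
Proof.
have [/[dup]/sqnorm_eq0 -> ->|w_neq0] := eqVneq (sqnorm w) 0.
  by exists (basisv R t0); rewrite ?sqnorm_basisv// sqrtr0 scale0r.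
have w_gt0 : 0 < sqnorm w by rewrite lt0r w_neq0 sqnorm_ge0.
exists ((Num.sqrt (sqnorm w))^-1%:C *: w).
  by rewrite sqnormZ normc_real real_normK ?num_real// exprVn sqr_sqrtr ?mulVf// ltW.
by rewrite scalerA -rmorphM mulfV ?scale1r// gt_eqF// sqrtr_gt0.
Qed.

Lemma separable_sum_kronv A B n (c : 'I_n -> R) (a : 'I_n -> A -> C)
    (b : 'I_n -> B -> C) :
  (forall k, 0 <= c k) -> \sum_k c k = 1 ->
  (forall k, sqnorm (a k) = 1) -> (forall k, sqnorm (b k) = 1) ->
  separable (\sum_k (c k)%:C *: ketbra (kronv (a k) (b k)) (kronv (a k) (b k))).
Proof.
move=> c0 c1 a1 b1.
exists n, c, (fun k => ketbra (a k) (a k)), (fun k => ketbra (b k) (b k)).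
split=> //; split=> //; split=> [k|x y]; first by split; exact: is_state_ketbra.
by rewrite sum_matE; apply: eq_bigr => k _; rewrite ketbra_kronv.
Qed.

Lemma unit_product_separation X A Y B (v : X -> A -> C) (u : Y -> B -> C)
    (p : X * Y -> R) (a0 : A) (b0 : B) :
  (exists n (c : 'I_n -> R) (a : 'I_n -> A -> C) (b : 'I_n -> B -> C),
    [/\ forall k, 0 <= c k, \sum_k c k = 1, forall k, sqnorm (a k) = 1,
        forall k, sqnorm (b k) = 1
      & forall z, p z = \sum_k c k * born (kron_frame v u) (kronv (a k) (b k)) z]) \/
  (exists h c, (forall a b, sqnorm a = 1 -> sqnorm b = 1 ->
      \sum_z h z * born (kron_frame v u) (kronv a b) z <= c) /\ c < \sum_z h z * p z).
Proof.
pose D := [set g | sqnorm (@cvec R A g) = 1] `*` [set g | sqnorm (@cvec R B g) = 1].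
pose f (g : realvec R A * realvec R B) :=
  born (kron_frame v u) (kronv (cvec g.1) (cvec g.2)).
have D0 : D !=set0.
  have [a aE] := cvec_surj (basisv R a0); have [b bE] := cvec_surj (basisv R b0).
  by exists (a, b); rewrite /D /= aE bE !sqnorm_basisv.
have cont_f z : continuous (f^~ z).
  rewrite /f; under [X in continuous X]eq_fun do rewrite born_kron.
  apply: continuous_funM => g.
    exact: (@continuous_comp _ _ _ fst (fun g => born v (cvec g) z.1) g cvg_fst
      (@continuous_born R A X v z.1 g.1)).
  exact: (@continuous_comp _ _ _ snd (fun g => born u (cvec g) z.2) g cvg_snd
      (@continuous_born R B Y u z.2 g.2)).
have cD : compact D by apply: compact_setX; exact: compact_unit_cvec.
have [[n [th [[th0 th1 thD] thE]]]|[h [c [hle hgt]]]] :=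
  separation_from_hull cD D0 cont_f p.
  left.
  exists n, (fun k => (th k).1), (fun k => cvec (th k).2.1), (fun k => cvec (th k).2.2).
  by split=> // [k|k|z]; [have [] := thD k|have [] := thD k|rewrite -thE].
right; exists h, c; split=> // a b.
have [ga <-] := cvec_surj a; have [gb <-] := cvec_surj b.
by move=> a1 b1; exact: (hle (ga, gb)).
Qed.

(* The separating functional is shifted to vanish at its maximum on unit product vectors
   and then extended to all product vectors by homogeneity. *)
Lemma entangled_witness X A Y B (v : X -> A -> C) (u : Y -> B -> C) (rho : bop A B) :
  parseval_frame v -> parseval_frame u -> infocomplete v -> infocomplete u ->
  entangled rho ->
  exists w : X * Y -> R,
    (forall a b, \sum_z w z * born (kron_frame v u) (kronv a b) z <= 0) /\
    0 < \sum_z w z * outcome (kron_frame v u) rho z.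
Proof.
move=> v1 u1 vc uc [[rho0 rho1] nsep]; have [[a0 b0]] := trm1_inhabited rho1.
have V1 := parseval_frame_kron v1 u1; pose V := kron_frame v u.
have [[n [c [a [b [c0 c1 a1 b1 pE]]]]]|[h [c [hle hgt]]]] :=
    unit_product_separation v u (outcome V rho) a0 b0.
  pose sigma : bop A B :=
    \sum_k (c k)%:C *: ketbra (kronv (a k) (b k)) (kronv (a k) (b k)).
  suff rhoE : rho = sigma by case: nsep; rewrite rhoE; exact: separable_sum_kronv.
  apply/subr0_eq/(infocomplete_eq0 (infocomplete_kron vc uc)) => z.
  rewrite linearB /= [qform _ sigma]linear_sum /= qform_psdE// pE rmorph_sum -sumrB
    big1// => k _.
  by rewrite linearZ /= qform_ketbra rmorphM subrr.
exists (fun z => h z - c); split; last first.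
  under eq_bigr do rewrite mulrBl.
  by rewrite sumrB -mulr_sumr sum_outcome// mulr1 subr_gt0.
move=> a b; have [a' a'1 ->] := unit_vector_scale a0 a.
have [b' b'1 ->] := unit_vector_scale b0 b.
set r := sqnorm a; set s := sqnorm b.
set ab := kronv _ _.
have -> : \sum_z (h z - c) * born V ab z
    = r * s * \sum_z (h z - c) * born V (kronv a' b') z.
  rewrite mulr_sumr; apply: eq_bigr => z _; rewrite !born_kron !bornZ !normc_real.
  by rewrite !real_normK ?num_real// !sqr_sqrtr ?sqnorm_ge0//; ring.
rewrite mulr_ge0_le0 ?mulr_ge0 ?sqnorm_ge0//; under eq_bigr do rewrite mulrBl.
by rewrite sumrB -mulr_sumr sum_born// sqnorm_kronv a'1 b'1 !mulr1 subr_le0 hle.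
Qed.

End Witness.

(** * Exponential tilting *)

Section RealTilt.
Variables (R : realType) (Z : finType).
Implicit Types p w g : Z -> R.

Lemma inv1D_le (y : R) : - 2^-1 <= y -> (1 + y)^-1 <= 1 - y + 2 * y ^+ 2.
Proof.
move=> y2; have y1 : 0 < 1 + y by lra.
rewrite -[leLHS]mul1r ler_pdivrMr//; have := sqr_ge0 y; nra.
Qed.

Lemma exists_tilt p w : (forall z, 0 <= p z) -> \sum_z p z = 1 ->
  0 < \sum_z w z * p z ->
  exists2 e : R, 0 < e & (forall z, 0 < 1 + e * w z) /\ \sum_z p z / (1 + e * w z) < 1.
Proof.
move=> p0 p1; set d := \sum_z w z * p z => d0; pose W := 1 + \sum_z `|w z|.
have wW z : `|w z| <= W.
  by rewrite /W (bigD1 z) //= addrCA lerDl addr_ge0// sumr_ge0.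
have dW : d <= W.
  rewrite -[W]mulr1 -p1 mulr_sumr; apply: ler_sum => z _.
  by rewrite ler_wpM2r// (le_trans (ler_norm _)).
have W0 : 0 < W := lt_le_trans d0 dW.
have W1 : 1 <= W by rewrite lerDl sumr_ge0.
pose e := d / (4 * W ^+ 2).
have e0 : 0 < e by rewrite divr_gt0// mulr_gt0// exprn_gt0.
have eW2 : e * W ^+ 2 = d / 4 by rewrite /e; field; rewrite gt_eqF.
have eW : e * W <= 2^-1.
  by rewrite -(ler_pM2r W0) -mulrA -expr2 eW2; lra.
have ew z : `|e * w z| <= e * W by rewrite normrM gtr0_norm// ler_pM2l.
have ew_ge z : - 2^-1 <= e * w z.
  by have := ler_norm (- (e * w z)); have := ew z; rewrite normrN; lra.
exists e => //; split=> [z|]; first by have := ew_ge z; lra.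
apply: (@le_lt_trans _ _ (\sum_z (p z - e * (w z * p z) + 2 * (e * W) ^+ 2 * p z))).
  apply: ler_sum => z _; have := ler_wpM2l (p0 z) (inv1D_le (ew_ge z)).
  have ew2 : (e * w z) ^+ 2 <= (e * W) ^+ 2.
    rewrite -(real_normK (num_real (e * w z))) lerXn2r ?nnegrE//.
    by rewrite mulr_ge0// ltW.
  have := ler_wpM2l (p0 z) ew2; lra.
rewrite big_split sumrB /= -!mulr_sumr p1 -/d mulr1 exprMn.
have -> : 2 * (e ^+ 2 * W ^+ 2) = e * d / 2 by rewrite expr2 -mulrA eW2; field.
by have := mulr_gt0 e0 d0; lra.
Qed.

Lemma markov_sum p g t : 0 < t -> (forall z, 0 <= p z) -> (forall z, 0 <= g z) ->
  \sum_(z | t <= g z) p z <= t^-1 * \sum_z g z * p z.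
Proof.
move=> t0 p0 g0; rewrite ler_pdivlMl// mulr_sumr [leRHS](bigID (fun z => t <= g z)) /=.
rewrite -[leLHS]addr0 lerD//; last by apply: sumr_ge0 => z _; rewrite mulr_ge0.
by apply: ler_sum => z tg; rewrite ler_wpM2r.
Qed.

End RealTilt.

Section ProductTilts.
Variable R : realType.
Local Notation C := R[i].
Local Notation bop := (bop R).
Implicit Types A B X Y T : finType.

Definition tilt_bounded X A Y B (v : X -> A -> C) (u : Y -> B -> C)
    (g : X * Y -> R) : Prop :=
  forall a b, \sum_z g z * born (kron_frame v u) (kronv a b) z <= sqnorm a * sqnorm b.

Lemma entangled_tilt A B (rho : bop A B) : entangled rho ->
  exists (X Y : finType) (v : X -> A -> C) (u : Y -> B -> C) (g : X * Y -> R),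
    [/\ parseval_frame v, parseval_frame u, forall z, 0 < g z, tilt_bounded v u g
      & \sum_z outcome (kron_frame v u) rho z / g z < 1].
Proof.
move=> ent; have [[rho0 rho1] _] := ent.
have v1 := @parseval_polar_frame R A; have u1 := @parseval_polar_frame R B.
have V1 := parseval_frame_kron v1 u1.
have [w [w_le w_gt]] := entangled_witness v1 u1 (@infocomplete_polar_frame R A)
  (@infocomplete_polar_frame R B) ent.
have [|e e0 [g0 g_lt]] := exists_tilt _ (sum_outcome V1 rho1) w_gt.
  by move=> z; exact: outcome_ge0.
exists _, _, (@polar_frame R A), (@polar_frame R B), (fun z => 1 + e * w z).
split=> //.
move=> a b; under eq_bigr do rewrite mulrDl mul1r -mulrA.
by rewrite big_split /= sum_born// sqnorm_kronv -mulr_sumr gerDl pmulr_rle0.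
Qed.

Definition slice T A (w : T * A -> C) (i : A) : T -> C := fun t => w (t, i).

Definition contract T A (c : T -> C) (w : T * A -> C) : A -> C :=
  fun i => dot c (slice w i).

Lemma born_contract X T X' A (v : X -> T -> C) (v' : X' -> A -> C) w x x' :
  born (kron_frame v v') w (x, x') = born v' (contract (v x) w) x'.
Proof.
congr (normc _ ^+ 2); rewrite /dot sum_pair exchange_big; apply: eq_bigr => i _.
rewrite mulr_sumr; apply: eq_bigr => t _.
by rewrite /kron_frame /kronv rmorphM mulrAC mulrC.
Qed.

Lemma sqnorm_contract X T A (v : X -> T -> C) (w : T * A -> C) x :
  sqnorm (contract (v x) w) = \sum_i born v (slice w i) x.
Proof. by []. Qed.

Lemma sum_sqnorm_slice T A (w : T * A -> C) : \sum_i sqnorm (slice w i) = sqnorm w.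
Proof. by rewrite [RHS]sum_pair exchange_big. Qed.

Definition kron_weight X Y X' Y' (g : X * Y -> R) (g' : X' * Y' -> R)
    (z : (X * X') * (Y * Y')) : R := g (z.1.1, z.2.1) * g' (z.1.2, z.2.2).

(* Measuring one factor of a product vector leaves a product vector on the other. *)
Lemma tilt_bounded_kron X A Y B X' A' Y' B' (v : X -> A -> C) (u : Y -> B -> C)
    (v' : X' -> A' -> C) (u' : Y' -> B' -> C) (g : X * Y -> R) (g' : X' * Y' -> R) :
  (forall z, 0 <= g z) -> tilt_bounded v u g -> tilt_bounded v' u' g' ->
  tilt_bounded (kron_frame v v') (kron_frame u u') (kron_weight g g').
Proof.
move=> g0 gb g'b a b.
apply: (@le_trans _ _ (\sum_x \sum_y g (x, y) *
    (sqnorm (contract (v x) a) * sqnorm (contract (u y) b)))).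
  rewrite !sum_pair; apply: ler_sum => x _; under eq_bigr do rewrite sum_pair.
  rewrite exchange_big; apply: ler_sum => y _ /=.
  apply: le_trans (ler_wpM2l (g0 (x, y)) (g'b (contract (v x) a) (contract (u y) b))).
  rewrite sum_pair mulr_sumr; apply: ler_sum => x' _.
  rewrite mulr_sumr; apply: ler_sum => y' _.
  by rewrite !born_kron !born_contract /kron_weight /= !mulrA.
rewrite [leLHS](_ : _ = \sum_i \sum_j \sum_z
    g z * born (kron_frame v u) (kronv (slice a i) (slice b j)) z); last first.
  under [RHS]eq_bigr do rewrite exchange_big.
  rewrite [RHS]exchange_big sum_pair; apply: eq_bigr => x _; apply: eq_bigr => y _.
  rewrite !sqnorm_contract mulr_suml mulr_sumr; apply: eq_bigr => i _.
  by rewrite !mulr_sumr; apply: eq_bigr => j _; rewrite born_kron.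
rewrite -(sum_sqnorm_slice a) -(sum_sqnorm_slice b) mulr_suml; apply: ler_sum => i _.
by rewrite mulr_sumr; apply: ler_sum => j _; exact: gb.
Qed.

End ProductTilts.

Section FfunCons.
Variables (n : nat) (T : finType).

Definition ffun_cons (p : T * {ffun 'I_n -> T}) : {ffun 'I_n.+1 -> T} :=
  [ffun i => oapp p.2 p.1 (unlift ord0 i)].

Lemma ffun_cons0 p : ffun_cons p ord0 = p.1.
Proof. by rewrite ffunE unlift_none. Qed.

Lemma ffun_consS p i : ffun_cons p (lift ord0 i) = p.2 i.
Proof. by rewrite ffunE liftK. Qed.

Lemma sum_ffun_cons (V : nmodType) (F : {ffun 'I_n.+1 -> T} -> V) :
  \sum_f F f = \sum_p F (ffun_cons p).
Proof.
apply: reindex; apply: onW_bij.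
exists (fun f : {ffun 'I_n.+1 -> T} => (f ord0, [ffun i => f (lift ord0 i)]))
  => [[t f]|f].
  by rewrite ffun_cons0; congr (_, _); apply/ffunP => i; rewrite ffunE ffun_consS.
apply/ffunP => i; case: (unliftP ord0 i) => [j|] ->; first by rewrite ffun_consS ffunE.
by rewrite ffun_cons0.
Qed.

End FfunCons.

(** * Collective measurements of tensor powers *)

Section PowerFrames.
Variable R : realType.
Local Notation C := R[i].
Local Notation bop := (bop R).
Implicit Types A B X Y : finType.

Definition pow_frame n X A (v : X -> A -> C) (x : {ffun 'I_n -> X})
    (a : {ffun 'I_n -> A}) : C := \prod_k v (x k) (a k).

Definition pow_weight n X Y (g : X * Y -> R)
    (z : {ffun 'I_n -> X} * {ffun 'I_n -> Y}) : R :=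
  \prod_k g (z.1 k, z.2 k).

Lemma parseval_frame_pow n X A (v : X -> A -> C) :
  parseval_frame v -> parseval_frame (@pow_frame n X A v).
Proof.
move=> v1; apply: eq_mat => a a'; rewrite sum_matE.
transitivity (\prod_(k < n) \sum_x v x (a k) * conjc (v x (a' k))).
  rewrite bigA_distr_bigA; apply: eq_bigr => x _.
  by rewrite /ketbra /pow_frame rmorph_prod -big_split.
rewrite -[RHS]prodr_eq_ffun; apply: eq_bigr => k _.
by rewrite -[RHS]/(idm A (a k) (a' k)) -v1 sum_matE.
Qed.

Lemma born_pow_frame_cons n X A (v : X -> A -> C) a x :
  born (@pow_frame n.+1 X A v) a (ffun_cons x)
  = born (kron_frame v (@pow_frame n X A v)) (a \o @ffun_cons n A) x.
Proof.
congr (normc _ ^+ 2); rewrite /dot sum_ffun_cons; apply: eq_bigr => p _.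
rewrite /pow_frame big_ord_recl !ffun_cons0; congr (conjc (_ * _) * _).
by apply: eq_bigr => k _; rewrite !ffun_consS.
Qed.

Lemma pow_weight_cons n X Y (g : X * Y -> R) x y :
  @pow_weight n.+1 X Y g (ffun_cons x, ffun_cons y)
  = kron_weight g (@pow_weight n X Y g) (x, y).
Proof.
rewrite /pow_weight big_ord_recl !ffun_cons0; congr (_ * _).
by apply: eq_bigr => k _; rewrite !ffun_consS.
Qed.

Lemma sqnorm_ffun_cons n A (a : {ffun 'I_n.+1 -> A} -> C) :
  sqnorm (a \o @ffun_cons n A) = sqnorm a.
Proof. by rewrite [RHS]sum_ffun_cons. Qed.

Lemma tilt_bounded_pow n X A Y B (v : X -> A -> C) (u : Y -> B -> C) (g : X * Y -> R) :
  parseval_frame v -> parseval_frame u -> (forall z, 0 <= g z) -> tilt_bounded v u g ->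
  tilt_bounded (@pow_frame n X A v) (@pow_frame n Y B u) (@pow_weight n X Y g).
Proof.
move=> v1 u1 g0 gb; elim: n => [|n IH] a b.
  under eq_bigr do rewrite /pow_weight big_ord0 mul1r.
  rewrite sum_born ?sqnorm_kronv//.
  by apply: parseval_frame_kron; exact: parseval_frame_pow.
have := tilt_bounded_kron g0 gb IH (a \o @ffun_cons n A) (b \o @ffun_cons n B).
rewrite !sqnorm_ffun_cons; apply: le_trans.
rewrite [leLHS]sum_pair sum_ffun_cons [leRHS]sum_pair; apply: ler_sum => x _.
rewrite sum_ffun_cons; apply: ler_sum => y _.
by rewrite !born_kron !born_pow_frame_cons pow_weight_cons.
Qed.

Lemma qform_tpow n X A Y B (v : X -> A -> C) (u : Y -> B -> C) (rho : bop A B) z :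
  qform (kron_frame (@pow_frame n X A v) (@pow_frame n Y B u) z) (tpow rho n)
  = \prod_k qform (kron_frame v u (z.1 k, z.2 k)) rho.
Proof.
under [RHS]eq_bigr do rewrite qformE.
rewrite qformE prod_sum_pair; apply: eq_bigr => i _.
rewrite prod_sum_pair; apply: eq_bigr => j _.
rewrite !big_split /=; congr (_ * _ * _); first rewrite -rmorph_prod /=;
  by rewrite /kron_frame /kronv big_split.
Qed.

Lemma outcome_tpow n X A Y B (v : X -> A -> C) (u : Y -> B -> C) (rho : bop A B) z :
  psd rho ->
  outcome (kron_frame (@pow_frame n X A v) (@pow_frame n Y B u)) (tpow rho n) z
  = \prod_k outcome (kron_frame v u) rho (z.1 k, z.2 k).
Proof.
move=> rho0; rewrite /outcome qform_tpow.
by under eq_bigr do rewrite qform_psdE//; rewrite -rmorph_prod.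
Qed.

End PowerFrames.

(** * Positivity of the entanglement cost *)

Section HypothesisTest.
Variable R : realType.
Local Notation C := R[i].
Local Notation mat := (mat R).
Local Notation bop := (bop R).
Implicit Types A B Q T X Y Z : finType.

Lemma sum_outcome_le_tnorm Z T (V : Z -> T -> C) (S : pred Z) (M : mat T T) :
  parseval_frame V -> herm M -> `|\sum_(z | S z) outcome V M z| <= tnorm M.
Proof.
move=> V1 hM; rewrite -Re_sum (le_trans (Re_le_normc _))//.
have -> : \sum_(z | S z) qform (V z) M
    = trm (mulm (\sum_(z | S z) ketbra (V z) (V z)) M).
  rewrite trm_mulmC !linear_sum; apply: eq_bigr => z _ /=.
  by rewrite trm_mulm_ketbra.
apply: le_tnorm => // w; rewrite linear_sum /=; under eq_bigr do rewrite qform_ketbra.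
rewrite -rmorph_sum normc_real ger0_norm ?sumr_ge0// => [|z _]; last exact: sqr_ge0.
rewrite -(sum_born w V1) [leRHS](bigID S) /=; under eq_bigr do rewrite normc_dotC.
by rewrite lerDl sumr_ge0// => z _; exact: born_ge0.
Qed.

(* A maximally entangled vector is a sum of [#|Q|] product vectors, so by Cauchy-Schwarz it
   gains at most a factor [#|Q|] over them. *)
Lemma outcome_kraus_maxent_le Q A B Z (V : Z -> A * B -> C)
    (s : seq (mat A Q * mat B Q)) z :
  outcome V (kraus (krons s) (@maxent R Q)) z
  <= \sum_(p <- s) \sum_i born V
    (kronv (mulmv p.1 (basisv R i)) (mulmv p.2 (basisv R i))) z.
Proof.
have maxentE : @maxent_vec R Q = \sum_i kronv (basisv R i) (basisv R i).
  apply/funext => x; rewrite fct_sumE -[LHS](sum_delta x.1 (fun i => (i == x.2)%:R)).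
  by apply: eq_bigr => i _; rewrite /kronv /basisv [_ == x.2]eq_sym.
rewrite /outcome /kraus big_map [qform _ _]linear_sum /= Re_sum;
  apply: ler_sum => p _ /=.
rewrite /maxent linearZ /= sandw_ketbra linearZ /= qform_ketbra.
rewrite maxentE [mulmv _ _]linear_sum [dot _ _]linear_sum /=.
under eq_bigr do rewrite /= mulmv_kron.
rewrite -(rmorph_nat (real_complex R)) -fmorphV -rmorphM /=.
have [->|Q0] := posnP #|Q|.
  by rewrite invr0 mul0r sumr_ge0// => i _; exact: born_ge0.
by rewrite ler_pdivrMl ?ltr0n//; exact: sqr_normc_sum_le.
Qed.

Lemma LOCC_maxent_outcome Q A B X Y (v : X -> A -> C) (u : Y -> B -> C)
    (Lam : bop Q Q -> bop A B) (S : pred (X * Y)) c : LOCC Lam ->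

    (forall a b,
       \sum_(z | S z) born (kron_frame v u) (kronv a b) z <= c * (sqnorm a * sqnorm b)) ->
  \sum_(z | S z) outcome (kron_frame v u) (Lam (@maxent R Q)) z <= c * #|Q|%:R.
Proof.
move=> /LOCC_separable_kraus[s [s1 ->]] born_le.
apply: (@le_trans _ _ (\sum_(p <- s) \sum_i
    c * sqnorm (mulmv (kron p.1 p.2) (kronv (basisv R i) (basisv R i))))).
  apply: (le_trans (ler_sum _ (fun z _ => outcome_kraus_maxent_le _ s z))).
  rewrite exchange_big; apply: ler_sum => p _; rewrite exchange_big;
    apply: ler_sum => i _ /=.
  by rewrite mulmv_kron sqnorm_kronv born_le.
rewrite exchange_big /= -sumr_const mulr_sumr; apply: ler_sum => i _.
rewrite -mulr_sumr.
have := sum_sqnorm_kraus (kronv (basisv R i) (basisv R i)) s1; rewrite big_map => ->.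
by rewrite sqnorm_kronv !sqnorm_basisv !mulr1.
Qed.

Section TiltedTest.
Variables (A B X Y : finType) (v : X -> A -> C) (u : Y -> B -> C) (g : X * Y -> R).
Hypotheses (v1 : parseval_frame v) (u1 : parseval_frame u).
Hypotheses (g0 : forall z, 0 < g z) (gb : tilt_bounded v u g).
Variables (rho : bop A B) (t : R) (m : nat).
Hypotheses (rho_state : is_state rho) (t0 : 0 < t).

Let V := kron_frame (@pow_frame R m X A v) (@pow_frame R m Y B u).
Let accept z := t ^+ m <= @pow_weight R m X Y g z.

Let V1 : parseval_frame V.
Proof. by apply: parseval_frame_kron; exact: parseval_frame_pow. Qed.

Let tm0 : 0 < t ^+ m. Proof. exact: exprn_gt0. Qed.

Let weight_gt0 z : 0 < @pow_weight R m X Y g z.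
Proof. exact: prodr_gt0. Qed.

Lemma sum_accept_product_le a b :
  \sum_(z | accept z) born V (kronv a b) z <= t ^- m * (sqnorm a * sqnorm b).
Proof.
apply: (le_trans (markov_sum tm0 _ _)) => [z|z|]; [exact: born_ge0|exact: ltW|].
rewrite ler_pM2l ?invr_gt0//; apply: tilt_bounded_pow => // z; exact: ltW.
Qed.

Lemma sum_reject_tpow_le :
  \sum_(z | ~~ accept z) outcome V (tpow rho m) z
  <= (t * \sum_z outcome (kron_frame v u) rho z / g z) ^+ m.
Proof.
have [rho0 _] := rho_state.
have P0 z : 0 <= outcome V (tpow rho m) z.
  by rewrite outcome_tpow// prodr_ge0// => k _; exact: outcome_ge0.
apply: (@le_trans _ _
    (\sum_(z | t ^- m <= (pow_weight g z)^-1) outcome V (tpow rho m) z)).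
  rewrite [leRHS]big_mkcond [leLHS]big_mkcond; apply: ler_sum => z _.
  rewrite lef_pV2 ?posrE// /accept -ltNge; case: ltP => [/ltW->//|_].
  by case: ifP.
apply: (le_trans (markov_sum _ P0 _)) => [|z|]; rewrite ?invr_gt0//.
  by rewrite invr_ge0 ltW.
rewrite invrK exprMn ler_pM2l// -[X in _ ^+ X]card_ord -prodr_const prod_sum_pair.
apply: ler_sum => z _.
by rewrite outcome_tpow// big_split prodfV mulrC.
Qed.

Lemma LOCC_maxent_far Q (Lam : bop Q Q -> bop {ffun 'I_m -> A} {ffun 'I_m -> B}) :
  LOCC Lam ->
  1 - (t * \sum_z outcome (kron_frame v u) rho z / g z) ^+ m - t ^- m * #|Q|%:R
  <= tnorm (subm (Lam (@maxent R Q)) (tpow rho m)).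
Proof.
move=> LamL; have [rho0 rho1] := rho_state.
have hM : herm (Lam (@maxent R Q) - tpow rho m).
  apply: hermB; last exact/herm_tpow/psd_herm.
  apply: herm_LOCC => //; exact: herm_maxent.
have := sum_outcome_le_tnorm accept V1 hM; rewrite ler_norml => /andP[+ _].
have := LOCC_maxent_outcome LamL sum_accept_product_le.
have := sum_reject_tpow_le.
have : \sum_z outcome V (tpow rho m) z = 1.
  by rewrite sum_outcome// trm_tpow rho1 expr1n.
rewrite (bigID accept) /=.
have -> : \sum_(z | accept z) outcome V (Lam (@maxent R Q) - tpow rho m) z =
    \sum_(z | accept z) outcome V (Lam (@maxent R Q)) z
    - \sum_(z | accept z) outcome V (tpow rho m) z.
  by rewrite -sumrB; apply: eq_bigr => z _; rewrite /outcome [qform _ _]linearB;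
    exact: raddfB.
move: (t * _) => ta; rewrite -/(subm _ _).
lra.
Qed.

End TiltedTest.

Lemma LOCC_psi_plus_far A B X Y (v : X -> A -> C) (u : Y -> B -> C) (g : X * Y -> R)
    (rho : bop A B) (t : R) l n m
    (Lam : bop {ffun 'I_n -> 'I_2} {ffun 'I_n -> 'I_2} ->
           bop {ffun 'I_m -> A} {ffun 'I_m -> B}) :
  let a := \sum_z outcome (kron_frame v u) rho z / g z in
  parseval_frame v -> parseval_frame u -> (forall z, 0 < g z) -> tilt_bounded v u g ->
  is_state rho -> 1 < t -> 0 <= t * a < 1 -> 4 <= t ^+ l -> (l * n <= m)%N ->
    LOCC Lam ->
  1 - (t * a) ^+ n - 2^-1 ^+ n <= tnorm (subm (Lam (tpow psi_plus n)) (tpow rho m)).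
Proof.
move=> a v1 u1 g0 gb st t1 /andP[ta0 ta1] tl lnm LamL.
have t0 : 0 < t by exact: lt_trans t1.
have l0 : (0 < l)%N by case: l tl {lnm} => //; rewrite expr0; lra.
have nm : (n <= m)%N by rewrite (leq_trans _ lnm)// leq_pmull.
have := LOCC_maxent_far v1 u1 g0 gb st t0 LamL.
rewrite -/a -tpow_psi_plus card_ffun !card_ord natrX; apply: le_trans.
rewrite lerB// ?lerB// ?ler_wiXn2l// ?(ltW ta1)//.
rewrite mulrC ler_pdivrMr ?exprn_gt0//.
apply: (@le_trans _ _ (2^-1 ^+ n * t ^+ (l * n))).
  by rewrite exprM -exprMn lerXn2r ?nnegrE//; lra.
by rewrite ler_pM2l ?exprn_gt0 ?invr_gt0// ler_weXn2l// ltW.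
Qed.

Lemma cvg_expr_lt1 (q : R) : 0 <= q < 1 -> (fun n => q ^+ n) @ \oo --> (0 : R).
Proof. by move=> /andP[q0 q1]; apply: cvg_expr; rewrite ger0_norm. Qed.

Lemma exists_expr_ge (t c : R) : 1 < t -> 0 < c -> exists l, c <= t ^+ l.
Proof.
move=> t1 c0; have t0 : 0 < t by exact: lt_trans t1.
have tV : 0 <= t^-1 < 1 by rewrite invr_ge0 (ltW t0) invf_lt1.
have : \forall n \near \oo, t^-1 ^+ n < c^-1.
  by apply: (cvgr_lt _ (cvg_expr_lt1 tV)); rewrite invr_gt0.
case=> l _ /(_ l (leqnn l)) /=; rewrite exprVn ltf_pV2 ?posrE ?exprn_gt0// => /ltW tl.
by exists l.
Qed.

Lemma rate_psi_plus_lty A B (rho : bop A B) : entangled rho ->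
  (rate psi_plus rho < +oo)%E.
Proof.
move=> ent; have [st _] := ent; have [rho0 rho1] := st.
have [X [Y [v [u [g [v1 u1 g0 gb]]]]]] := entangled_tilt ent.
set a := \sum_z _ => a1.
have a0 : 0 <= a by apply: sumr_ge0 => z _; rewrite divr_ge0 ?outcome_ge0// ltW.
pose t := 2 / (1 + a).
have t1 : 1 < t by rewrite ltr_pdivlMr; lra.
have ta1 : 0 <= t * a < 1.
  by rewrite mulr_ge0 ?(le_trans ler01 (ltW t1))//= /t mulrAC ltr_pdivrMr; lra.
have [l tl] := exists_expr_ge t1 (ltr0n _ 4).
apply: (@le_lt_trans _ _ l%:R%:E); last exact: ltry.
apply: ge_ereal_sup => _ [r [r0 [m [Lam [LamL [mr err]]]]] <-].
rewrite lee_fin leNgt; apply/negP => lr.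
have total0 : (fun n => tnorm (subm (Lam n (tpow psi_plus n)) (tpow rho (m n)))
    + (t * a) ^+ n + 2^-1 ^+ n) @ \oo --> (0 : R).
  rewrite -[0](addr0 0) -[X in X + 0](addr0 0); apply: cvgD; first apply: cvgD => //.
    exact: cvg_expr_lt1.
  by apply: cvg_expr_lt1; lra.
suff : \forall n \near \oo, False by case=> N _ /(_ N (leqnn N)).
near=> n.
have n0 : (0 : R) < n%:R by rewrite ltr0n; near: n; exact: nbhs_infty_gt.
have lmn : (l * n <= m n)%N.
  by rewrite -(ler_nat R) natrM -ler_pdivlMr// ltW//; near: n; exact: (cvgr_gt _ mr).
have := LOCC_psi_plus_far v1 u1 g0 gb st t1 ta1 tl lmn (LamL n).
have : tnorm (subm (Lam n (tpow psi_plus n)) (tpow rho (m n)))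
    + (t * a) ^+ n + 2^-1 ^+ n < 1 by near: n; exact: (cvgr_lt _ total0).
rewrite -/a; lra.
Unshelve. all: by end_near. Qed.

End HypothesisTest.

Local Open Scope ereal_scope.

Section EntanglementCost.
Variables (R : realType) (A B : finType) (rho : bop R A B).

Lemma E_c_entangled : entangled rho ->
  exists r : R, [/\ (0 < r)%R, rate psi_plus rho = r%:E & E_c rho = (r^-1)%:E].
Proof.
move=> ent; have [st _] := ent; rewrite /E_c.
have := rate_psi_plus_gt0 st; have := rate_psi_plus_lty ent.
case: (rate psi_plus rho) => [r| |]// _ r0; exists r; split=> //.
by rewrite inver gt_eqF.
Qed.

Lemma E_D_mul_rate_le_sym_ent : is_state rho ->
  E_D rho * rate psi_plus rho <= sym_ent rho.
Proof.
move=> [/psd_herm hrho rho1]; rewrite -(rate_psi_plus_swap hrho).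
by apply: rate_trans => //;
  [exact: trm_psi_plus|exact: herm_psi_plus|exact: herm_swapop].
Qed.

Lemma sym_ent_le1 : entangled rho -> sym_ent rho <= 1.
Proof.
move=> ent; have [r [r0 rE _]] := E_c_entangled ent;
  have [[/psd_herm hrho rho1] _] := ent.
rewrite -(lee_pmul2l (x := r%:E))// mule1 -[leRHS]rE -(rate_psi_plus_swap hrho) -rE.
by apply: rate_trans => //;
  [exact: trm_psi_plus|exact: herm_psi_plus|exact: herm_swapop].
Qed.

End EntanglementCost.

Theorem theorem2 (R : realType) (A B : finType) (rho : bop R A B) :
  entangled rho ->
  [/\ E_D rho / E_c rho <= sym_ent rho,
      sym_ent rho <= 1,
      asym_ent rho <= E_b rho / E_c rho
    & 0 < asym_ent rho -> E_D rho < E_c rho].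
Proof.
move=> ent; have [st _] := ent; have [_ rho1] := st.
have [r [r0 rE costE]] := E_c_entangled ent.
have sym_le1 := sym_ent_le1 ent.
have distill_le_sym := E_D_mul_rate_le_sym_ent st; rewrite rE in distill_le_sym.
have div_cost x : x / E_c rho = x * r%:E by rewrite costE inver invr_eq0 gt_eqF// invrK.
have sym_fin : sym_ent rho \is a fin_num.
  by rewrite ge0_fin_numE ?rate_ge0// (le_lt_trans sym_le1)// ltry.
have distill_fin : E_D rho \is a fin_num.
  rewrite ge0_fin_numE ?rate_ge0// (le_lt_trans (y := sym_ent rho * (r^-1)%:E))//.
    by rewrite lee_pdivlMr.
  by rewrite -(fineK sym_fin) ltry.
rewrite !div_cost /asym_ent /E_b costE; split=> //; move: distill_le_sym;
  rewrite -(fineK sym_fin) -(fineK distill_fin) lee_fin => distill_le_sym.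
  by rewrite lee_fin mulrBl mulVf ?gt_eqF// lerB.
by rewrite !lte_fin subr_gt0 -[(r^-1)%R]mul1r ltr_pdivlMr//; exact: le_lt_trans.
Qed.
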